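(* Let $p$ be an odd prime, $A\subseteq \mathbb{F}_p$ a set, and let $\mathsf{T}(A)$ be the number of collinear triples in $A\times A$. Then $$0 \le \mathsf{T}(A) - \frac{|A|^6}{p} \ll \min\left\{ p^{1/2} |A|^{7/2}, |A|^{9/2} \right\}.$$
   Context: $\mathsf{T}(A)$ counts ordered triples of points $((a,a'),(b,b'),(c,c'))\in (A\times A)^3$ lying on a common line, i.e. the number of $(a,a',b,b',c,c')\in A^6$ with $(b-a)(c'-a')=(c-a)(b'-a')$. $\ll$ denotes inequality up to an absolute constant. *)

(* Defs.v *)
From HB Require Import structures.
From mathcomp Require Import all_boot all_order all_algebra.
From mathcomp Require Import ring.

Set Implicit Arguments.
Unset Strict Implicit.
Unset Printing Implicit Defensive.

Import GRing.Theory.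
Local Open Scope ring_scope.

(* Coincident points are allowed: a triple in which two points agree is always
   collinear. *)
Definition collinear (F : fieldType) (P Q S : F * F) : bool :=
  (Q.1 - P.1) * (S.2 - P.2) == (S.1 - P.1) * (Q.2 - P.2).

Lemma collinearP (F : fieldType) (P Q S : F * F) :
  reflect (exists u v w : F, (u, v) != (0, 0) /\
             forall X : F * F, X \in [:: P; Q; S] -> u * X.1 + v * X.2 = w)
          (collinear P Q S).
Proof.
apply: (iffP eqP) => [H | [u [v [w [nz H]]]]].
  case: P Q S H => [p p'] [q q'] [s s'] /= H.
  have [[eq1 eq2]|nPQ] := eqVneq (p, p') (q, q').
    have [[eq3 eq4]|nPS] := eqVneq (p, p') (s, s').
      exists 1, 0, p; split; first by rewrite xpair_eqE oner_eq0.
      move=> X; rewrite !inE -eq1 -eq2 -eq3 -eq4.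
      by do 2?[case/orP]; move/eqP=> -> /=; ring.
    exists (s' - p'), (p - s), ((s' - p') * p + (p - s) * p'); split.
      apply: contra nPS; rewrite !xpair_eqE !subr_eq0 => /andP[/eqP-> /eqP->].
      by rewrite !eqxx.
    move=> X; rewrite !inE -eq1 -eq2.
    by do 2?[case/orP]; move/eqP=> -> /=; ring.
  exists (q' - p'), (p - q), ((q' - p') * p + (p - q) * p'); split.
    apply: contra nPQ; rewrite !xpair_eqE !subr_eq0 => /andP[/eqP-> /eqP->].
    by rewrite !eqxx.
  move=> X; rewrite !inE; case/or3P => /eqP-> /=; [by [] | by ring |].
  have -> : (q' - p') * s + (p - q) * s' = (q' - p') * p + (p - q) * p'
     + ((s - p) * (q' - p') - (q - p) * (s' - p')) by ring.
  by rewrite H subrr addr0.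
have HP := H P; have HQ := H Q; have HS := H S.
rewrite !inE !eqxx ?orbT /= in HP HQ HS.
have {}HQ : u * (Q.1 - P.1) + v * (Q.2 - P.2) = 0.
  by transitivity (w - w); [rewrite -{1}HQ // -HP //; ring | rewrite subrr].
have {}HS : u * (S.1 - P.1) + v * (S.2 - P.2) = 0.
  by transitivity (w - w); [rewrite -{1}HS // -HP //; ring | rewrite subrr].
set x := Q.1 - P.1 in HQ *; set y := Q.2 - P.2 in HQ *.
set z := S.1 - P.1 in HS *; set t := S.2 - P.2 in HS *.
apply/eqP; rewrite -subr_eq0.
have Hu : u * (x * t - z * y) = 0.
  have -> : u * (x * t - z * y) = (u * x + v * y) * t - (u * z + v * t) * y
    by ring.
  by rewrite HQ HS !mul0r subrr.
have Hv : v * (x * t - z * y) = 0.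
  have -> : v * (x * t - z * y) = (u * z + v * t) * x - (u * x + v * y) * z
    by ring.
  by rewrite HQ HS !mul0r subrr.
move: nz; rewrite xpair_eqE negb_and.
by case/orP=> /negPf nz; [move/eqP: Hu | move/eqP: Hv]; rewrite mulf_eq0 nz.
Qed.

Definition collinear_triples (F : finFieldType) (A : {set F}) : nat :=
  #|[set t : (F * F) * (F * F) * (F * F) |
      [&& t.1.1 \in setX A A, t.1.2 \in setX A A, t.2 \in setX A A
        & collinear t.1.1 t.1.2 t.2]]|.

(* Main.v *)
Require Import Defs.
From HB Require Import structures.
From mathcomp Require Import all_boot all_order all_algebra.
From mathcomp Require Import reals exp.
From mathcomp Require Import fraction mpoly ring lra zify.

(* Writing n = |A| and i(l) for the number of points of A x A on the line l, the
   sums of i, i^2 and i^3 over the p^2 non-vertical lines are explicit in n, p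
   and T(A). The lower bound is the Cauchy-Schwarz inequality
   (sum i^2)^2 <= (sum i)(sum i^3). For the upper bound, lines with i(l) < k are
   controlled by the second moment and the others by the estimate
   #{l : i(l) >= k} << n^5 / k^4, valid as soon as k^2 p >> n^3; one takes
   k ~ n^{3/2} p^{-1/2} if n^2 >= p and k ~ n^{1/2} otherwise.

   The estimate for a set L of k-rich lines comes from counting the solutions of
   l'(x) = l(x') with x, x' in A and l, l' in L: there are at least (k |L|)^2 / n
   by Cauchy-Schwarz, and this is a point-plane incidence count of Rudnev type
   with N = n |L| points and planes. Points and planes are turned into two
   families of lines with directions (1, t, t^2), incidence becoming
   intersection. Suppose every line of a subfamily meets many others, and let F
   be a polynomial of least degree d = O(N^{1/2}) < p vanishing on all of them.
   Some line l is not contained in the singular locus of F = 0. The surface has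
   at most two such directions at a smooth point, and since there are more than
   5d crossings on each line, the second derivative of F in the second direction
   vanishes identically on every line. Differentiating this along the lines that
   cross l shows that on l the ratio of the two remaining partial derivatives is
   an affine function, so all lines crossing l at smooth points correspond to
   points on a common line; their number is bounded directly. *)

Set Implicit Arguments.
Unset Strict Implicit.
Unset Printing Implicit Defensive.

Import Order.TTheory GRing.Theory Num.Theory.
Local Open Scope ring_scope.

(** * Isotropic lines in three-space *)

Section IsotropicLines.
Variable K : fieldType.
Implicit Types (F G : {mpoly K[3]}) (t u v s : K).

Let iX : 'I_3 := inord 0.
Let iY : 'I_3 := inord 1.
Let iZ : 'I_3 := inord 2.

Lemma ord3_ind (P : 'I_3 -> Prop) : P iX -> P iY -> P iZ -> forall i, P i.
Proof.
move=> h0 h1 h2 i; rewrite -[i]inord_val.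
by case: i => -[|[|[|//]]] lt_i3 /=.
Qed.

(* The line through (0, u, v) with the isotropic direction (1, t, t^2),
   parametrised by its first coordinate. *)
Definition line_coord t u v (i : 'I_3) : {poly K} :=
  [:: 'X; u%:P + t *: 'X; v%:P + t ^+ 2 *: 'X]`_i.

Definition restr t u v F : {poly K} := mmap (@polyC K) (line_coord t u v) F.

HB.instance Definition _ t u v :=
  GRing.RMorphism.copy (restr t u v) (mmap (@polyC K) (line_coord t u v)).

Lemma restrZ t u v c F : restr t u v (c *: F) = c *: restr t u v F.
Proof. by rewrite /restr mmapZ mul_polyC. Qed.

Lemma size_restr t u v F : (size (restr t u v F) <= msize F)%N.
Proof.
rewrite /restr /mmap (leq_trans (size_sum _ _ _)) //.
apply/bigmax_leqP_seq => m m_in _; rewrite mul_polyC.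
rewrite (leq_trans (size_scale_leq _ _)) // (leq_trans _ (msize_mdeg_lt m_in)) //.
rewrite /mmap1 (leq_trans (size_prod_leq _ _)) // card_ord mdegE.
have szL i : (size (line_coord t u v i) <= 2)%N.
  elim/ord3_ind: i; rewrite /line_coord /iX /iY /iZ inordK //= ?size_polyX //;
  rewrite (leq_trans (size_polyD _ _)) // geq_max;
  by rewrite (leq_trans (size_polyC_leq1 _)) ?(leq_trans (size_scale_leq _ _)) ?size_polyX.
have : (\sum_i size (line_coord t u v i ^+ m i) <= \sum_(i < 3) (m i).+1)%N.
  apply: leq_sum => i _; rewrite (leq_trans (size_poly_exp_leq _ _)) //.
  by have := szL i; case: (size _) => [|[|[|//]]] //=; rewrite ?mul0n ?mul1n.
rewrite [in X in (_ <= X)%N -> _](eq_bigr (fun i => m i + 1)%N); last by move=> *; rewrite addn1.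
by rewrite big_split /= sum1_card card_ord => le_s; rewrite leq_subLR addnS ltnS addnC.
Qed.

Lemma horner_restr t u v t' u' v' s F :
    u + t * s = u' + t' * s -> v + t ^+ 2 * s = v' + t' ^+ 2 * s ->
  (restr t u v F).[s] = (restr t' u' v' F).[s].
Proof.
move=> eu ev; rewrite /restr /mmap !horner_sum; apply: eq_bigr => m _.
rewrite !hornerM !hornerC /mmap1 !horner_prod; congr (_ * _).
apply: eq_bigr => i _; rewrite !horner_exp; congr (_ ^+ _).
by elim/ord3_ind: i; rewrite /line_coord /iX /iY /iZ inordK //=
  !(hornerD, hornerC, hornerZ, hornerX).
Qed.

(** The vectors (1, t, t^2), (0, 1, 2t), (0, 0, 1) are the Taylor coefficients at t of the curve of
    isotropic directions, so moving t by d expands [dD] exactly into [dD], [dE] and [dZ]. *)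
Definition dD t F := F^`M(iX) + t *: F^`M(iY) + t ^+ 2 *: F^`M(iZ).
Definition dE t F := F^`M(iY) + (t *+ 2) *: F^`M(iZ).
Definition dZ F := F^`M(iZ).

Lemma deriv_line_coord t u v i :
  (line_coord t u v i)^`() = [:: 1; t%:P; (t ^+ 2)%:P]`_i.
Proof.
by elim/ord3_ind: i; rewrite /line_coord /iX /iY /iZ inordK //=
  ?derivD ?derivC ?derivZ ?derivX ?add0r ?alg_polyC.
Qed.

(** Chain rule along a line of velocity (1, t, t^2). Both sides are linear in F and obey the Leibniz
    rule, so checking the variables suffices. *)
Lemma deriv_restr t u v F : (restr t u v F)^`() = restr t u v (dD t F).
Proof.
have -> : restr t u v (dD t F) =
    \sum_i restr t u v F^`M(i) * (line_coord t u v i)^`().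
  have sum3 (f : 'I_3 -> {poly K}) : \sum_i f i = f iX + f iY + f iZ.
    rewrite !big_ord_recl big_ord0 addr0 addrA.
    by congr (f _ + f _ + f _); apply: val_inj; rewrite /= inordK.
  rewrite sum3 !deriv_line_coord /iX /iY /iZ !inordK //= /dD !rmorphD /= !restrZ.
  by rewrite mulr1 -![_ * _%:P]mulrC !mul_polyC.
elim/mpolyind: F => [|c m F _ _ IH].
  by rewrite !rmorph0 deriv0 big1 // => i _; rewrite mderiv0 rmorph0 mul0r.
rewrite rmorphD /= restrZ derivD derivZ {}IH.
under [RHS]eq_bigr => i _ do rewrite mderivD mderivZ rmorphD /= restrZ mulrDl -scalerAl.
rewrite big_split /= -scaler_sumr; congr (_ *: _ + _).
have chain1 : (restr t u v 1)^`() = \sum_i restr t u v 1^`M(i) * (line_coord t u v i)^`().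
  rewrite rmorph1 derivC big1 // => i _.
  by rewrite -mpolyC1 mderivC rmorph0 mul0r.
have chainM G H :
    (restr t u v G)^`() = \sum_i restr t u v G^`M(i) * (line_coord t u v i)^`() ->
    (restr t u v H)^`() = \sum_i restr t u v H^`M(i) * (line_coord t u v i)^`() ->
  (restr t u v (G * H))^`() = \sum_i restr t u v (G * H)^`M(i) * (line_coord t u v i)^`().
  rewrite rmorphM derivM => -> ->.
  rewrite [X in X + _]mulr_suml [X in _ + X]mulr_sumr -big_split /=.
  apply: eq_bigr => i _; rewrite mderivM rmorphD !rmorphM /=; ring.
rewrite mpolyXE_id.
apply: (big_ind (fun G => (restr t u v G)^`() =
  \sum_i restr t u v G^`M(i) * (line_coord t u v i)^`())) => // i _.
elim: (m i) => [|n IHn]; first exact: chain1.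
rewrite exprS; apply: chainM => //.
rewrite (bigD1 i) //= mderivX mnm1E eqxx (_ : (U_(i) - U_(i) = 0)%MM) 
  ?mpolyX0 ?scale1r ?rmorph1 ?mul1r; last by apply/mnmP => j; rewrite mnmBE subnn mnm0E.
rewrite big1 ?addr0 => [|j ne_ji]; last first.
  by rewrite mderivX mnm1E eq_sym (negPf ne_ji) scale0r rmorph0 mul0r.
by rewrite /restr mmapX mmap1U.
Qed.

Lemma dD_shift t d F : dD (t + d) F = dD t F + d *: dE t F + d ^+ 2 *: dZ F.
Proof.
have shift (V : lmodType K) (x y z : V) : x + (t + d) *: y + (t + d) ^+ 2 *: z =
    x + t *: y + t ^+ 2 *: z + d *: (y + (t *+ 2) *: z) + d ^+ 2 *: z.
  have -> : (t + d) ^+ 2 = t ^+ 2 + d * (t *+ 2) + d ^+ 2 by ring.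
  by rewrite scalerDr scalerA !scalerDl !addrA [LHS](ACl (1*2*4*3*5*6)).
exact: shift.
Qed.

Lemma dDdE t F : dD t (dE t F) = dE t (dD t F).
Proof.
have swap (V : lmodType K) (xy xz yy yz zz : V) :
    xy + (t *+ 2) *: xz + t *: (yy + (t *+ 2) *: yz) + t ^+ 2 *: (yz + (t *+ 2) *: zz) =
    xy + t *: yy + t ^+ 2 *: yz + (t *+ 2) *: (xz + t *: yz + t ^+ 2 *: zz).
  rewrite !scalerDr !scalerA !addrA ![_ * (t *+ 2)]mulrC.
  by rewrite [LHS](ACl (1*3*5*2*4*6)).
rewrite /dD /dE; do !rewrite mderivD mderivZ.
rewrite [_^`M(iX)^`M(iY)]mderiv_comm ![_^`M(iX)^`M(iZ)]mderiv_comm.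
rewrite [_^`M(iY)^`M(iZ)]mderiv_comm.
exact: swap.
Qed.

Lemma dDdZ t F : dD t (dZ F) = dZ (dD t F).
Proof.
by rewrite /dD /dZ; do !rewrite mderivD mderivZ; rewrite ![_^`M(iZ)^`M(_)]mderiv_comm.
Qed.

Lemma dDD t F G : dD t (F + G) = dD t F + dD t G.
Proof.
have addB (V : lmodType K) (x y z x' y' z' : V) :
    x + x' + t *: (y + y') + t ^+ 2 *: (z + z') =
    x + t *: y + t ^+ 2 *: z + (x' + t *: y' + t ^+ 2 *: z').
  by rewrite !scalerDr !addrA [LHS](ACl (1*3*5*2*4*6)).
by rewrite /dD !mderivD; apply: addB.
Qed.

Lemma dDZ t c F : dD t (c *: F) = c *: dD t F.
Proof.
have mulB (V : lmodType K) (x y z : V) :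
    c *: x + t *: (c *: y) + t ^+ 2 *: (c *: z) = c *: (x + t *: y + t ^+ 2 *: z).
  by rewrite !scalerDr !scalerA ![c * _]mulrC.
by rewrite /dD !mderivZ; apply: mulB.
Qed.

(* On a line of direction t' in the surface F = 0, the tangent plane contains
   one further isotropic direction t + S / C. This is the second derivative of
   F in that direction, multiplied by C ^ 4. *)
Definition curv t t' u' v' F : {poly K} :=
  let r := restr t' u' v' in
  let C := r (dZ F) in
  let S := - (r (dE t F) + (t' - t) *: C) in
  C ^+ 4 * r (dD t (dD t F)) + (S * C ^+ 3 * r (dD t (dE t F))) *+ 2
  + S ^+ 2 * C ^+ 2 * (r (dE t (dE t F)) + r (dD t (dZ F)) *+ 2)
  + (S ^+ 3 * C * r (dE t (dZ F))) *+ 2 + S ^+ 4 * r (dZ (dZ F)).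

(** All terms after the first two carry S ^ 2, so their derivatives vanish where S does. *)
Lemma quartic_deriv (C S g0 g1 g2 g3 g4 : {poly K}) s :
    S.[s] = 0 -> g0.[s] = 0 ->
  (C ^+ 4 * g0 + (S * C ^+ 3 * g1) *+ 2 + S ^+ 2 * C ^+ 2 * g2
   + (S ^+ 3 * C * g3) *+ 2 + S ^+ 4 * g4)^`().[s] =
  C.[s] ^+ 3 * (C.[s] * g0^`().[s] + (S^`().[s] * g1.[s]) *+ 2).
Proof.
move=> S0 g00.
have [r eqG r0] : exists2 r : {poly K}, C ^+ 4 * g0 + (S * C ^+ 3 * g1) *+ 2 +
    S ^+ 2 * C ^+ 2 * g2 + (S ^+ 3 * C * g3) *+ 2 + S ^+ 4 * g4 =
    C ^+ 4 * g0 + S * (C ^+ 3 * g1 *+ 2 + r) & r.[s] = 0.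
  exists (S * (C ^+ 2 * g2 + (S * C * g3) *+ 2 + S ^+ 2 * g4)); first by ring.
  by rewrite hornerM S0 mul0r.
rewrite eqG derivD !derivM !(hornerD, hornerM) r0 S0 g00.
by ring.
Qed.

(* The derivative of [curv] along the line of direction t' at a crossing point
   involves only the restrictions of F to the line of direction t: there S
   vanishes, and the second free isotropic direction is t itself. *)
Lemma curv_deriv_eq t u v t' u' v' s F :
    t' != t -> u + t * s = u' + t' * s -> v + t ^+ 2 * s = v' + t' ^+ 2 * s ->
    restr t u v F = 0 -> restr t' u' v' F = 0 -> curv t t' u' v' F = 0 ->
  let a := restr t u v (dE t F) in let b := restr t u v (dZ F) in
  ((a^`() * (a^`() * b - a * b^`())) *+ 2
   - a * (a^`()^`() * b - a * b^`()^`())).[s] = 0.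
Proof.
move=> ne_t eu ev F0 F0' curv0 a b.
pose d := t' - t; have d0 : d != 0 by rewrite subr_eq0.
have t'E : t' = t + d by rewrite /d addrC subrK.
have evE G : (restr t' u' v' G).[s] = (restr t u v G).[s].
  by apply/esym/horner_restr.
have D0 G : restr t u v G = 0 -> restr t u v (dD t G) = 0.
  by move=> G0; rewrite -deriv_restr G0 deriv0.
have D0' G : restr t' u' v' G = 0 -> restr t' u' v' (dD t' G) = 0.
  by move=> G0; rewrite -deriv_restr G0 deriv0.
have evD G : (restr t' u' v' (dD t' G)).[s] = (restr t u v (dD t G)).[s]
    + d * (restr t u v (dE t G)).[s] + d ^+ 2 * (restr t u v (dZ G)).[s].
  by rewrite evE t'E dD_shift 2!(rmorphD (restr t u v)) /= 2!restrZ 2!hornerD 2!hornerZ.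
(* The first and second derivatives of F along the second line vanish at s. In the frame at t, the
   first gives a = - d b there, and the second gives the derivative of S. *)
have h1 := congr1 (horner^~ s) (D0' _ F0').
have h2 := congr1 (horner^~ s) (D0' _ (D0' _ F0')).
rewrite /= horner0 evD D0 // horner0 add0r in h1.
have t'D : dD t' F = dD t F + d *: dE t F + d ^+ 2 *: dZ F.
  by rewrite -dD_shift -t'E.
rewrite /= horner0 [in dD t' (dD t' F)]t'D 2!dDD 2!dDZ in h2.
rewrite 2!(rmorphD (restr t' u' v')) /= 2!restrZ 2!hornerD 2!hornerZ in h2.
rewrite 3!evD (D0 _ (D0 _ F0)) horner0 add0r -dDdE -dDdZ in h2.
have D2F' : (restr t' u' v' (dD t (dD t F)))^`().[s] =
    d * (a^`()^`().[s] + d * b^`()^`().[s]).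
  rewrite deriv_restr evD (D0 _ (D0 _ (D0 _ F0))) horner0 add0r.
  by rewrite /a /b !deriv_restr -!dDdE -!dDdZ; ring.
have a0E : a.[s] = - (d * b.[s]).
  apply: (mulfI d0); rewrite /a /b; apply/eqP; rewrite -subr_eq0; apply/eqP.
  by rewrite -[RHS]h1; ring.
have := congr1 (fun P => P^`().[s]) curv0.
rewrite /curv /= -/d deriv0 horner0.
set C := restr t' u' v' (dZ F); set S := - _.
have C0E : C.[s] = b.[s] by rewrite /C evE.
have S0 : S.[s] = 0.
  by rewrite /S hornerN hornerD hornerZ evE -/a a0E C0E; ring.
have S'E : S^`().[s] = a^`().[s] + d * b^`().[s].
  rewrite /S /C derivN derivD derivZ hornerN hornerD hornerZ !deriv_restr 2!evD.
  apply: (mulfI d0); apply/eqP; rewrite -subr_eq0 -oppr_eq0; apply/eqP.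
  by rewrite -[RHS]h2; ring.
have g0E : (restr t' u' v' (dD t (dD t F))).[s] = 0.
  by rewrite evE (D0 _ (D0 _ F0)) horner0.
have g1E : (restr t' u' v' (dD t (dE t F))).[s] = a^`().[s].
  by rewrite evE /a deriv_restr.
rewrite quartic_deriv // g1E D2F' S'E C0E.
rewrite !(hornerD, hornerN, hornerM, hornerMn) a0E.
(* The derivative of [curv] carries the factor C ^ 3. If C vanishes at s, so do b and a, and the
   claim is trivial; otherwise the claimed expression is b times the other factor. *)
move/eqP; rewrite mulf_eq0 expf_eq0 /= => /orP[/eqP-> | /eqP eqH].
  by ring.
transitivity (b.[s] * 0); last by rewrite mulr0.
by rewrite -eqH; ring.
Qed.
(** At the crossing F has zero derivative in the directions t' and t2, so S = (t2 - t) C there and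
    [curv] equals C ^ 4 times the second derivative of F along the crossing line, which is zero.
    Here t is only the origin of the frame. *)
Lemma curv_cross t t' u' v' t2 u2 v2 s F :
    t2 != t' -> u' + t' * s = u2 + t2 * s -> v' + t' ^+ 2 * s = v2 + t2 ^+ 2 * s ->
    restr t' u' v' F = 0 -> restr t2 u2 v2 F = 0 ->
  root (curv t t' u' v' F) s.
Proof.
move=> ne_t eu ev F0 F2.
have evE G : (restr t2 u2 v2 G).[s] = (restr t' u' v' G).[s].
  by apply/esym/horner_restr.
pose d := t' - t; pose h := t2 - t.
have t'E : t' = t + d by rewrite /d addrC subrK.
have t2E : t2 = t + h by rewrite /h addrC subrK.
have hd : h - d != 0 by rewrite /h /d opprB addrA subrK subr_eq0.
have shift e G : (restr t' u' v' (dD (t + e) G)).[s] = (restr t' u' v' (dD t G)).[s]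
    + e * (restr t' u' v' (dE t G)).[s] + e ^+ 2 * (restr t' u' v' (dZ G)).[s].
  by rewrite dD_shift 2!(rmorphD (restr t' u' v')) /= 2!restrZ 2!hornerD 2!hornerZ.
have h1 : (restr t' u' v' (dD t' F)).[s] = 0 by rewrite -deriv_restr F0 deriv0 horner0.
have h2 : (restr t' u' v' (dD t2 F)).[s] = 0.
  by rewrite -evE -deriv_restr F2 deriv0 horner0.
have h3 : (restr t' u' v' (dD t2 (dD t2 F))).[s] = 0.
  by rewrite -evE -!deriv_restr F2 !deriv0 horner0.
rewrite [in dD t' F]t'E shift in h1; rewrite [in dD t2 F]t2E shift in h2.
have t2D : dD t2 F = dD t F + h *: dE t F + h ^+ 2 *: dZ F by rewrite -dD_shift -t2E.
rewrite [in dD t2 (dD t2 F)]t2D 2!dDD 2!dDZ in h3.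
rewrite 2!(rmorphD (restr t' u' v')) /= 2!restrZ 2!hornerD 2!hornerZ in h3.
rewrite t2E 3!shift -dDdE -dDdZ in h3.
have EZ : dZ (dE t F) = dE t (dZ F).
  rewrite /dZ /dE mderivD mderivZ; congr (_ + _).
  exact: mderiv_comm.
rewrite EZ in h3.
have SE : - ((restr t' u' v' (dE t F)).[s] + d * (restr t' u' v' (dZ F)).[s]) =
    h * (restr t' u' v' (dZ F)).[s].
  apply: (mulfI hd); apply/eqP; rewrite -subr_eq0; apply/eqP.
  by have /= := congr2 (fun x y => x - y) h1 h2; rewrite subr0 => <-; ring.
rewrite /root /curv -/d; set C := restr t' u' v' (dZ F) in SE *.
rewrite !(hornerD, hornerM, hornerMn, horner_exp, hornerN, hornerZ) SE.
apply/eqP; transitivity (C.[s] ^+ 4 * 0); last by rewrite mulr0.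
by rewrite -h3; ring.
Qed.

Lemma msize_mderiv i F : (msize F^`M(i) <= (msize F).-1)%N.
Proof.
rewrite msizeE; apply/bigmax_leqP_seq => m; rewrite mcoeff_msupp mcoeff_deriv => nz _.
have /msize_mdeg_lt : (m + U_(i))%MM \in msupp F.
  by rewrite mcoeff_msupp; apply: contraNneq nz => ->; rewrite mul0rn.
by rewrite mdegD mdeg1 addn1; case: (msize F).
Qed.

Lemma msize_mderiv_le i F : (msize F^`M(i) <= msize F)%N.
Proof. exact: leq_trans (msize_mderiv _ _) (leq_pred _). Qed.

Lemma msize_dD t F : (msize (dD t F) <= msize F)%N.
Proof.
rewrite /dD (leq_trans (msizeD_le _ _)) // geq_max (leq_trans (msizeD_le _ _)) ?geq_max.
  by rewrite (leq_trans (msizeZ_le _ _)) ?msize_mderiv_le.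
by rewrite (leq_trans (msizeZ_le _ _)) ?msize_mderiv_le.
Qed.

Lemma msize_dE t F : (msize (dE t F) <= msize F)%N.
Proof.
rewrite /dE (leq_trans (msizeD_le _ _)) // geq_max msize_mderiv_le.
by rewrite (leq_trans (msizeZ_le _ _)) ?msize_mderiv_le.
Qed.

Lemma msize_dZ F : (msize (dZ F) <= msize F)%N.
Proof. exact: msize_mderiv_le. Qed.

(** Each term has five factors: four among C and S, and one second derivative of F. *)
Lemma size_curv t t' u' v' F : (size (curv t t' u' v' F) <= (5 * msize F).+1)%N.
Proof.
have szD a (p q : {poly K}) : (size p <= a)%N -> (size q <= a)%N -> (size (p + q)%R <= a)%N.
  by move=> hp hq; rewrite (leq_trans (size_polyD _ _)) // geq_max hp.
have szM a b c (p q : {poly K}) : (a + b = c)%N ->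
    (size p <= a.+1)%N -> (size q <= b.+1)%N -> (size (p * q)%R <= c.+1)%N.
  move=> <- hp hq; rewrite (leq_trans (size_polyMleq _ _)) //.
  by have := leq_add hp hq; rewrite addnS addSn; case: (_ + _)%N.
set m := msize F.
have szr G : (msize G <= m)%N -> (size (restr t' u' v' G) <= m.+1)%N.
  by move=> szG; rewrite (leq_trans (size_restr _ _ _ _)) // (leq_trans szG).
have szX k (p : {poly K}) : (size p <= m.+1)%N -> (size (p ^+ k)%R <= (k * m).+1)%N.
  move=> hp; apply: (leq_trans (size_poly_exp_leq _ _)); rewrite ltnS mulnC leq_mul2l.
  by apply/orP; right; rewrite -subn1 leq_subLR add1n.
have szMn a (p : {poly K}) : (size p <= a)%N -> (size (p *+ 2)%R <= a)%N.
  by move=> hp; apply: (szD).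
have mD G : (msize G <= m)%N -> (msize (dD t G) <= m)%N by apply/leq_trans/msize_dD.
have mE G : (msize G <= m)%N -> (msize (dE t G) <= m)%N by apply/leq_trans/msize_dE.
have mZ G : (msize G <= m)%N -> (msize (dZ G) <= m)%N by apply/leq_trans/msize_dZ.
have m0 : (msize F <= m)%N by [].
have szC := szr _ (mZ _ m0).
rewrite /curv; set C := restr t' u' v' (dZ F) in szC *; set S := - _.
have szS : (size S <= m.+1)%N.
  rewrite /S size_polyN; apply: (szD); first by apply/szr/mE.
  by rewrite (leq_trans (size_scale_leq _ _)).
apply: (szD); [apply: (szD); [apply: (szD); [apply: (szD)|]|]|].
- by apply: (szM (4 * m)%N m); [lia|apply: (szX)|apply/szr/mD/mD].
- apply: (szMn); apply: (szM (m + 3 * m)%N m); [lia| |apply/szr/mD/mE => //].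
  by apply: (szM) => //; apply: (szX).
- apply: (szM (2 * m + 2 * m)%N m); [lia|by apply: (szM) => //; apply: (szX)|].
  by apply: (szD); [apply/szr/mE/mE|apply: (szMn); apply/szr/mD/mZ].
- apply: (szMn); apply: (szM (3 * m + m)%N m); [lia| |apply/szr/mE/mZ => //].
  by apply: (szM) => //; apply: (szX).
- by apply: (szM (4 * m)%N m); [lia|apply: (szX)|apply/szr/mZ/mZ].
Qed.
(** F has zero derivative at the crossing in both directions; by [dD_shift] the difference of the
    two derivatives is divisible by t' - t. *)
Lemma cross_tangent t u v t' u' v' s F :
    t' != t -> u + t * s = u' + t' * s -> v + t ^+ 2 * s = v' + t' ^+ 2 * s ->
    restr t u v F = 0 -> restr t' u' v' F = 0 ->
  (restr t u v (dE t F)).[s] + (t' - t) * (restr t u v (dZ F)).[s] = 0.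
Proof.
move=> ne_t eu ev F0 F0'; have d0 : t' - t != 0 by rewrite subr_eq0.
apply: (mulfI d0); rewrite mulr0.
have := deriv_restr t' u' v' F; rewrite F0' deriv0 => /(congr1 (horner^~ s)) /=.
rewrite horner0 -(horner_restr _ eu ev) -[in dD _ _](subrKC t t') dD_shift.
rewrite 2!(rmorphD (restr t u v)) /= 2!restrZ 2!hornerD 2!hornerZ.
by rewrite -deriv_restr F0 deriv0 horner0 => ->; ring.
Qed.

Lemma restr_grad0 t u v F :
    restr t u v (dD t F) = 0 -> restr t u v (dE t F) = 0 -> restr t u v (dZ F) = 0 ->
  forall i, restr t u v F^`M(i) = 0.
Proof.
rewrite /dD /dE /dZ !rmorphD /= !restrZ => + + Z0; rewrite Z0 !scaler0 !addr0.
move=> + Y0; rewrite Y0 scaler0 addr0 => X0.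
by elim/ord3_ind.
Qed.
End IsotropicLines.

(** * Univariate polynomials of degree below the characteristic *)

Lemma coef_mul_top (R : comNzRingType) (p q : {poly R}) a b :
  (size p <= a.+1)%N -> (size q <= b.+1)%N -> (p * q)`_(a + b) = p`_a * q`_b.
Proof.
move=> szp szq; rewrite coefM.
have lt_a : (a < (a + b).+1)%N by rewrite ltnS leq_addr.
rewrite (bigD1 (Ordinal lt_a)) //= addKn big1 ?addr0 // => i ne_ia.
have [lt_ia|le_ai] := ltnP i a.
  by rewrite [q`__]nth_default ?mulr0 // (leq_trans szq) // ltn_subRL; lia.
rewrite nth_default ?mul0r // (leq_trans szp) // ltn_neqAle le_ai andbT.
by apply: contraNneq ne_ia => ai; apply/eqP/val_inj.
Qed.

(** The degrees have to stay below the characteristic: in characteristic l the polynomials X ^ l and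
    1 have zero Wronskian. *)
Lemma wronskian0 (K : fieldType) (p q : {poly K}) n :
    (forall m, (0 < m < n)%N -> m%:R != 0 :> K) -> (size p <= n)%N -> (size q <= n)%N ->
    q != 0 -> p^`() * q = p * q^`() ->
  exists c, p = c *: q.
Proof.
move=> char_n szp szq q0 W.
(* Subtracting a multiple of q makes the degrees differ, and then the leading
   coefficients of the two sides cannot agree. *)
suff [c] : exists c, (p - c *: q == 0) ||
    (size (p - c *: q) != size q) && (size (p - c *: q)%R <= n)%N.
  set r := p - c *: q => r_or; exists c; apply/eqP; rewrite -subr_eq0 -/r.
  case/orP: r_or => [//|/andP[ne_sz szr]].
  have Wr : r^`() * q = r * q^`().
    by rewrite /r derivB derivZ !mulrBl W -!scalerAl [q * _]mulrC.
  apply: contraNT ne_sz => r0.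
  have coefXd (f : {poly K}) i : ('X * f^`())`_i = f`_i *+ i.
    by rewrite coefXM; case: i => //= i; rewrite coef_deriv.
  have szXd (f : {poly K}) : f != 0 -> (size ('X * f^`())%R <= (size f).-1.+1)%N.
    move=> f0; apply/leq_sizeP => j le_j; rewrite coefXd nth_default ?mul0rn //.
    by rewrite -(prednK (n := size f)) // lt0n size_poly_eq0.
  have szS (f : {poly K}) : (size f <= (size f).-1.+1)%N by case: (size f).
  (* The factor X restores the degree lost by differentiation, so comparing top coefficients shows
     that the degrees of r and q agree in K. *)
  have := congr1 (fun f => ('X * f)`_((size r).-1 + (size q).-1)) Wr.
  rewrite /= mulrA coef_mul_top ?szXd // [r * _]mulrC mulrA [_ * r]mulrC coef_mul_top ?szXd //.
  rewrite !coefXd -/(lead_coef r) -/(lead_coef q) => /eqP.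
  rewrite mulrnAl mulrnAr -subr_eq0
    -[X in X - _]mulr_natr -[X in _ - X]mulr_natr -mulrBr !mulf_eq0 !lead_coef_eq0.
  rewrite (negPf r0) (negPf q0) /= subr_eq0 => eq_deg.
  have nat_neq a b : (a < b)%N -> (b < n)%N -> (b%:R : K) != a%:R.
    move=> ab bn; rewrite -subr_eq0 -natrB 1?ltnW //; apply: char_n.
    by rewrite subn_gt0 ab (leq_ltn_trans (leq_subr _ _)).
  have sr : (0 < size r)%N by rewrite lt0n size_poly_eq0.
  have sq : (0 < size q)%N by rewrite lt0n size_poly_eq0.
  move: eq_deg szr szq sr sq; move: (size r) (size q) => [|a] [|b] //= eq_ab ha hb _ _.
  case: (ltngtP a b) => [lt_ab|lt_ba|eq_ab']; last by rewrite eq_ab'.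
    by rewrite eq_sym (negPf (nat_neq _ _ lt_ab hb)) in eq_ab.
  by rewrite (negPf (nat_neq _ _ lt_ba ha)) in eq_ab.
have [ne|eq_sz] := eqVneq (size p) (size q); last first.
  by exists 0; rewrite scale0r subr0 eq_sz szp orbT.
exists (lead_coef p / lead_coef q); set r := _ - _.
have szr : (size r <= size q)%N.
  rewrite (leq_trans (size_polyD _ _)) // size_polyN geq_max ne leqnn /=.
  by rewrite (leq_trans (size_scale_leq _ _)).
apply/orP; right; rewrite (leq_trans szr) // andbT neq_ltn; apply/orP; left.
have sq : (0 < size q)%N by rewrite lt0n size_poly_eq0.
rewrite -(prednK sq) ltnS; apply/leq_sizeP => j.
rewrite leq_eqVlt => /orP[/eqP <-|lt_j].
  rewrite coefB coefZ /lead_coef ne divfK ?subrr //.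
  by rewrite -/(lead_coef q) lead_coef_eq0.
by rewrite nth_default // (leq_trans szr) // -(prednK sq).
Qed.

Lemma card_roots (R : idomainType) (T : finType) (J : {set T}) (f : T -> R) (p : {poly R}) :
  p != 0 -> {in J &, injective f} -> {in J, forall j, root p (f j)} -> (#|J| < size p)%N.
Proof.
move=> p0 inj_f rt; rewrite cardE -(size_map f); apply: max_poly_roots => //.
  by apply/allP => _ /mapP[j + ->]; rewrite mem_enum; apply: rt.
rewrite map_inj_in_uniq ?enum_uniq // => i j; rewrite !mem_enum; exact: inj_f.
Qed.

(** * Lines crossing a fixed line of a surface *)

Section Crossing.
Variable K : fieldType.

(** By contradiction: with more than 5d + k crossings, a relation of degree at most 3d that holds at
    all of them is an identity. The identities obtained put all crossings with a <> 0 on one affine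
    line, which leaves at most d + k. *)
Lemma crossing_bound (T : finType) (J : {set T}) (t' u' v' s : T -> K) (t u v : K)
    (F : {mpoly K[3]}) (d k : nat) :
    (forall m, (0 < m < (3 * d).+1)%N -> m%:R != 0 :> K) -> (msize F <= d)%N ->
    {in J, forall j, [/\ t' j != t, u + t * s j = u' j + t' j * s j,
      v + t ^+ 2 * s j = v' j + t' j ^+ 2 * s j, restr (t' j) (u' j) (v' j) F = 0
      & curv t (t' j) (u' j) (v' j) F = 0]} ->
    {in J &, injective s} -> restr t u v F = 0 ->
    ~~ [forall i, restr t u v F^`M(i) == 0] ->
    (forall k0 k1 k2 : K, (k1 != 0%R) || (k2 != 0%R) ->
      #|[set j in J | (k0 + k1 * t' j + k2 * u' j)%R == 0%R]| <= k)%N ->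
  (#|J| <= 5 * d + k)%N.
Proof.
move=> char_d szF crossJ inj_s F0 grad0 colJ; rewrite leqNgt; apply/negP => gt_J.
pose a := restr t u v (dE t F); pose b := restr t u v (dZ F).
have sza : (size a <= d)%N.
  by rewrite (leq_trans (size_restr _ _ _ _)) // (leq_trans (msize_dE _ _)).
have szb : (size b <= d)%N.
  by rewrite (leq_trans (size_restr _ _ _ _)) // (leq_trans (msize_dZ _)).
have root0 (p : {poly K}) : (size p <= (3 * d).+1)%N -> {in J, forall j, root p (s j)} -> p = 0.
  move=> szp rt; apply: contraTeq gt_J => p0; rewrite -leqNgt.
  have := leq_trans (card_roots p0 inj_s rt) szp.
  by rewrite ltnS => /leq_trans; apply; lia.
have ab j : j \in J -> a.[s j] + (t' j - t) * b.[s j] = 0.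
  by case/crossJ => ne eu ev Fj _; apply: cross_tangent Fj.
(* If a were zero, the tangency relation would make b vanish at every crossing, hence identically,
   and the gradient would vanish along the line. *)
have a0 : a != 0.
  apply: contraNneq grad0 => a0; apply/forallP => i; apply/eqP.
  apply: restr_grad0 => //; first by rewrite -deriv_restr F0 deriv0.
  apply: root0 => [|j jJ]; first by rewrite -/b; lia.
  have := ab j jJ; rewrite a0 horner0 add0r => /eqP; rewrite mulf_eq0 subr_eq0.
  by case/crossJ: (jJ) => /negPf-> _ _ _ _.
have szM m n (p q : {poly K}) : (size p <= m)%N -> (size q <= n)%N -> (size (p * q)%R <= m + n)%N.
  move=> hp hq; rewrite (leq_trans (size_polyMleq _ _)) //.
  by rewrite (leq_trans (leq_pred _)) // leq_add.
have szB m (p q : {poly K}) : (size p <= m)%N -> (size q <= m)%N -> (size (p - q)%R <= m)%N.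
  by move=> hp hq; rewrite (leq_trans (size_polyD _ _)) // size_polyN geq_max hp.
have szd m (p : {poly K}) : (size p <= m)%N -> (size p^`() <= m)%N.
  apply: leq_trans; have [->|p0] := eqVneq p 0; first by rewrite deriv0.
  exact/ltnW/lt_size_deriv.
have szW (a1 b1 : {poly K}) : (size a1 <= d)%N -> (size b1 <= d)%N ->
    (size (a1 * b - a * b1)%R <= d + d)%N.
  by move=> ha hb; apply: (szB); apply: (szM).
pose W := a^`() * b - a * b^`().
have H0 : (a^`() * W) *+ 2 - a * W^`() = 0.
  have -> : W^`() = a^`()^`() * b - a * b^`()^`() by rewrite /W derivB !derivM; ring.
  apply: root0 => [|j jJ]; last first.
    by case/crossJ: jJ => ne eu ev Fj cj; apply/eqP; apply: curv_deriv_eq cj.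
  rewrite -mulrnAl -/W; apply: leq_trans (_ : d + (d + d) <= _)%N; last by lia.
  apply: (szB); apply: (szM) => //; last by apply: (szW); do 2?apply: (szd).
    by rewrite mulr2n -[X in _ + X]opprK; apply: (szB); rewrite ?size_polyN; apply: (szd).
  by apply: (szW); apply: (szd).
(* (W / a^2)' = 0, hence (b / a)' = - W / a^2 is a constant and b / a is
   affine; hence the lines that cross where a <> 0 have their parameters (t', u')
   on one affine line. *)
have [c Wc] : exists c, W = c *: a ^+ 2.
  apply: (@wronskian0 _ _ _ (3 * d).+1) => //; rewrite ?expf_neq0 //.
  - by apply: leq_trans (_ : d + d <= _)%N; [apply: (szW); apply: (szd)|lia].
  - by apply: leq_trans (_ : d + d <= _)%N; [apply: (szM)|lia].
  - rewrite expr2 derivM.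
    transitivity (W^`() * (a * a) + a * 0); first by rewrite mulr0 addr0.
    by rewrite -H0; ring.
have [g bE] : exists g, b + c *: ('X * a) = g *: a.
  apply: (@wronskian0 _ _ _ (3 * d).+1) => //.
  - case: (posnP d) => [d0|d_gt0].
      by move: sza; rewrite d0 leqn0 size_poly_eq0 (negPf a0).
    rewrite -[_ *: _]opprK; apply: (szB); first by lia.
    rewrite size_polyN (leq_trans (size_scale_leq _ _)) //.
    apply: leq_trans (_ : 2 + d <= _)%N; last by lia.
    by apply: (szM); rewrite ?size_polyX.
  - by lia.
  - rewrite derivD derivZ derivM derivX mul1r.
    transitivity ((c *: a ^+ 2) - W + (b + c *: ('X * a)) * a^`()).
      rewrite /W -!mul_polyC; ring.
    by rewrite Wc subrr add0r.
(* Dividing the tangency relation by a gives 1 + (t' - t) (g - c s) = 0; the product (t' - t) s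
   equals u - u', so this is affine in t' and u'. *)
have lin j : j \in J -> ~~ root a (s j) -> (1 - g * t - c * u) + g * t' j + c * u' j == 0.
  move=> jJ; rewrite /root => aj0.
  have := congr1 (horner^~ (s j)) bE; rewrite /= !(hornerD, hornerZ, hornerM, hornerX) => bj.
  case/crossJ: (jJ) => ne eu _ _ _.
  apply/eqP/(mulfI aj0); rewrite mulr0 -[RHS](ab j jJ).
  have -> : b.[s j] = g * a.[s j] - c * (s j * a.[s j]) by rewrite -bj addrK.
  have -> : u' j = u - (t' j - t) * s j by rewrite mulrBl opprB addrA eu addrK.
  ring.
have le_r : (#|[set j in J | root a (s j)]| <= d)%N.
  rewrite (leq_trans (ltnW (card_roots (f := s) a0 _ _))) // => [i j|j]; rewrite !inE.
    by move=> /andP[iJ _] /andP[jJ _]; apply: inj_s.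
  by case/andP.
have le_l : (#|[set j in J | ~~ root a (s j)]| <= k)%N.
  (* For g = c = 0 the affine relation reads 1 = 0, so a vanishes at every crossing. *)
  have [/eqP cg0|cg0] := boolP ((g == 0) && (c == 0)).
    rewrite (_ : [set _ in _ | _] = set0) ?cards0 //; apply/setP => j; rewrite !inE.
    apply/negP => /andP[jJ /(lin j jJ)]; case/eqP/andP: cg0 => /eqP-> /eqP->.
    by rewrite !mul0r !subr0 !addr0 oner_eq0.
  rewrite negb_and in cg0; apply: leq_trans (subset_leq_card _) (colJ _ _ _ cg0).
  by apply/subsetP => j; rewrite !inE => /andP[jJ]; rewrite jJ; apply: lin.
have : (#|J| <= d + k)%N.
  apply: leq_trans (leq_add le_r le_l); rewrite -cardsUI.
  rewrite (leq_trans _ (leq_addr _ _)) // subset_leq_card //.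
  by apply/subsetP => j jJ; rewrite !inE jJ; case: root.
by lia.
Qed.
End Crossing.

(** * Interpolation and the crossing graph of a family of lines *)

Lemma exists_kernel (K : fieldType) (I J : finType) (M : I -> J -> K) :
  (#|J| < #|I|)%N ->
  exists2 c : I -> K, exists i, c i != 0 & forall j, \sum_i c i * M i j = 0.
Proof.
move=> lt_JI; pose A : 'M[K]_(#|I|, #|J|) := \matrix_(i, j) M (enum_val i) (enum_val j).
have : kermx A != 0.
  by rewrite -mxrank_eq0 mxrank_ker -lt0n subn_gt0 (leq_ltn_trans (rank_leq_col A)).
case/rowV0Pn => w /sub_kermxP wA w0; exists (fun i => w 0 (enum_rank i)).
  case/rV0Pn: w0 => i wi; exists (enum_val i); by rewrite enum_valK.
move=> j; have := congr1 (fun B : 'rV_ _ => B 0 (enum_rank j)) wA.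
rewrite /= !mxE => eq0; rewrite -[RHS]eq0 (reindex (@enum_val _ I)) /=; last first.
  exact/onW_bij/enum_val_bij.
by apply: eq_bigr => i _; rewrite !mxE enum_valK enum_rankK.
Qed.

(** A positive exponent in the leading monomial is less than d, hence invertible, so that monomial
    survives differentiation. *)
Lemma mpoly_grad_neq0 (K : fieldType) n (F : {mpoly K[n]}) (d : nat) :
    (forall m, (0 < m < d)%N -> m%:R != 0 :> K) -> (msize F <= d)%N -> (1 < msize F)%N ->
  exists i, F^`M(i) != 0.
Proof.
move=> char_d szF gt1.
have [m mF dm] : exists2 m, m \in msupp F & (0 < mdeg m)%N.
  have F0 : F != 0 by apply: contraTneq gt1 => ->; rewrite msize0.
  by exists (mlead F); [apply: mlead_supp | rewrite -ltnS mlead_deg].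
have [i mi] : exists i, (0 < m i)%N.
  apply/existsP; apply: contraTT dm; rewrite negb_exists => /forallP m0.
  by rewrite mdegE big1 // => i _; apply/eqP; rewrite eqn0Ngt.
exists i; apply: contraTneq (mF) => Fi; rewrite mcoeff_msupp negbK.
have mE : (m = m - U_(i) + U_(i))%MM by rewrite submK // lep1mP -lt0n.
have := congr1 (mcoeff (m - U_(i))%MM) Fi.
rewrite mcoeff0 mcoeff_deriv -mE mnmBE mnm1E eqxx subn1 prednK //.
move/eqP; rewrite -mulr_natr mulf_eq0 => /orP[//|/idPn[]]; apply: char_d.
rewrite mi /= (leq_trans _ szF) // (leq_ltn_trans _ (msize_mdeg_lt mF)) //.
by rewrite mdegE (bigD1 i) //= leq_addr.
Qed.

Section Incidence.
Variables (K : fieldType) (T : finType) (e : rel T) (t u v : T -> K).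

(** The first coordinate of the crossing, solved from the equation of the second coordinates. *)
Let cross i j := (u j - u i) / (t i - t j).

(** Dimension count: there are b ^ 3 monomials with all exponents below b, and vanishing on one line
    costs at most 3b linear conditions. *)
Lemma exists_vanishing (S : {set T}) b :
  (#|S| * 3 < b ^ 2)%N ->
  exists F : {mpoly K[3]},
    [/\ F != 0, (msize F <= 3 * b)%N & {in S, forall i, restr (t i) (u i) (v i) F = 0}].
Proof.
move=> ltSb.
have b_gt0 : (0 < b)%N by case: b ltSb.
pose I := {ffun 'I_3 -> 'I_b}; pose J := ({i : T | i \in S} * 'I_(3 * b))%type.
pose mon (f : I) := [multinom val (f i) | i < 3].
have mon_inj : injective mon.
  move=> f g /mnmP eq_fg; apply/ffunP => i; apply: val_inj.
  by have := eq_fg i; rewrite !mnmE.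
have deg_mon f : (mdeg (mon f) < 3 * b)%N.
  rewrite mdegE !big_ord_recl big_ord0 !mnmE.
  by have := (ltn_ord (f ord0), ltn_ord (f (lift ord0 ord0)),
    ltn_ord (f (lift ord0 (lift ord0 ord0)))) => -[[]] /=; lia.
pose M (f : I) (x : J) := (restr (t (val x.1)) (u (val x.1)) (v (val x.1)) 'X_[mon f])`_(val x.2).
have /(@exists_kernel _ _ _ M)[c [f0 cf0] cM] : (#|{: J}| < #|{: I}|)%N.
  rewrite card_prod card_ffun !card_ord card_sig.
  have -> : #|[pred x | x \in S]| = #|S| by apply: eq_card.
  by rewrite expnSr mulnA ltn_pmul2r.
pose F := \sum_f c f *: 'X_[mon f]; exists F.
have szF : (msize F <= 3 * b)%N.
  rewrite /F (leq_trans (msize_sum _ _ _)) //; apply/bigmax_leqP => f _.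
  by rewrite (leq_trans (msizeZ_le _ _)) // msizeX.
split=> // [|i iS].
  apply/eqP => /(congr1 (mcoeff (mon f0))); rewrite mcoeff0 raddf_sum /=.
  rewrite (bigD1 f0) //= big1 ?addr0 => [|f ne_f].
    by rewrite mcoeffZ mcoeffX eqxx mulr1; apply/eqP.
  by rewrite mcoeffZ mcoeffX (inj_eq mon_inj) (negPf ne_f) mulr0.
apply/polyP => r; rewrite coef0.
have [le_br|lt_rb] := leqP (3 * b) r.
  by rewrite nth_default // (leq_trans (size_restr _ _ _ _)) // (leq_trans szF).
have := cM (Sub i iS, Ordinal lt_rb); rewrite /M /= => cM0; rewrite -[RHS]cM0.
rewrite /F (rmorph_sum (restr _ _ _)) coef_sum; apply: eq_bigr => f _.
by rewrite /= restrZ coefZ.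
Qed.

(* The induction on [msize F] replaces F by a partial derivative as long as the
   gradient vanishes on every line. *)
Lemma sparse_vertex (S : {set T}) (F : {mpoly K[3]}) d k :
    (forall m, (0 < m < (3 * d).+1)%N -> m%:R != 0 :> K) ->
    (forall i j, e i j -> t j != t i) ->
    (forall i j, e i j -> v i + t i ^+ 2 * cross i j = v j + t j ^+ 2 * cross i j) ->
    (forall i j l, e i j -> e i l -> cross i j = cross i l -> j = l) ->
    (forall i k0 k1 k2, i \in S -> (k1 != 0%R) || (k2 != 0%R) ->
      #|[set j in S | e i j && ((k0 + k1 * t j + k2 * u j)%R == 0%R)]| <= k)%N ->
    S != set0 -> F != 0 -> (msize F <= d)%N ->
    {in S, forall i, restr (t i) (u i) (v i) F = 0} ->
  exists2 i, i \in S & (#|[set j in S | e i j]| <= 5 * d + k)%N.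
Proof.
move=> char_d ne_t eq_v cross_inj col S0.
have eq_u i j : e i j -> u i + t i * cross i j = u j + t j * cross i j.
  move=> eij; apply/eqP; rewrite -subr_eq0 /cross; apply/eqP; field.
  by rewrite subr_eq0 eq_sym ne_t.
case: (pickP (fun i => (i \in S) && (#|[set j in S | e i j]| <= 5 * d + k)%N))
  => [i /andP[]|sparse].
  by exists i.
have dense i : i \in S -> (5 * d + k < #|[set j in S | e i j]|)%N.
  by move=> iS; have := sparse i; rewrite iS /= ltnNge => ->.
move: {2}(msize F) (leqnn (msize F)) => n; elim: n F => [|n IH] F.
  by rewrite leqn0 msize_poly_eq0 => /eqP-> /eqP.
move=> leFn F0 szF Fv.
have [grad0|] := boolP [forall i in S, forall l, restr (t i) (u i) (v i) F^`M(l) == 0].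
  have gt1 : (1 < msize F)%N.
    rewrite ltnNge; apply/negP => /msize1_polyC FE.
    case/set0Pn: S0 => i iS; have := Fv i iS; rewrite FE /restr mmapC => /eqP.
    by rewrite polyC_eq0 => /eqP c0; rewrite FE c0 mpolyC0 eqxx in F0.
  have [l Fl] : exists l, F^`M(l) != 0.
    apply: (@mpoly_grad_neq0 _ _ _ d) => // m /andP[m0 md]; apply: char_d.
    by rewrite m0 /=; lia.
  have szl : (msize F^`M(l) < msize F)%N.
    by rewrite (leq_ltn_trans (msize_mderiv _ _)) // prednK // ltnW.
  apply: (IH F^`M(l)) => //.
  - by rewrite -ltnS (leq_trans szl).
  - by rewrite (leq_trans (ltnW szl)).
  - by move=> i iS; apply/eqP; have /forallP/(_ l) := forall_inP grad0 i iS.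
rewrite negb_forall_in => /exists_inP[i iS grad_i].
have := dense i iS; rewrite ltnNge => /negP[].
apply: (@crossing_bound _ _ _ t u v (cross i) (t i) (u i) (v i) F) => //.
- move=> j; rewrite inE => /andP[jS eij]; split; rewrite ?ne_t ?eq_u ?eq_v ?Fv //.
  have inj_j : {in [set l in S | e j l] &, injective (cross j)}.
    by move=> l l'; rewrite !inE => /andP[_ jl] /andP[_ jl']; apply: cross_inj.
  (* Line j has more than 5d crossings as well, each a root of a polynomial of degree at most 5d. *)
  apply: contraTeq (dense j jS) => curv0; rewrite -leqNgt.
  have /leq_trans : (#|[set l in S | e j l]| < size (curv (t i) (t j) (u j) (v j) F))%N.
    apply: card_roots inj_j _ => // l; rewrite inE => /andP[lS ejl].
    by apply: curv_cross (ne_t _ _ ejl) (eq_u _ _ ejl) (eq_v _ _ ejl) (Fv _ jS) (Fv _ lS).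
  move=> /(_ _ (size_curv _ _ _ _ _)); rewrite ltnS => /leq_trans; apply; lia.
- by move=> j l; rewrite !inE => /andP[_ eij] /andP[_ eil]; apply: cross_inj.
- exact: Fv.
- move=> k0 k1 k2 /(col i k0 k1 k2 iS); apply: leq_trans.
  by apply/subset_leq_card/subsetP => j; rewrite !inE -andbA.
Qed.

(** Vertices of degree at most 15b + k are removed one at a time, each costing at most twice its
    degree in ordered pairs. A single F, vanishing on all of S, serves for every remaining
    subset. *)
Lemma edge_bound (S : {set T}) b k :
    (#|S| * 3 < b ^ 2)%N ->
    (forall m, (0 < m < (9 * b).+1)%N -> m%:R != 0 :> K) ->
    (forall i j, e i j -> t j != t i) ->
    (forall i j, e i j -> v i + t i ^+ 2 * cross i j = v j + t j ^+ 2 * cross i j) ->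
    (forall i j l, e i j -> e i l -> cross i j = cross i l -> j = l) ->
    (forall i k0 k1 k2, i \in S -> (k1 != 0%R) || (k2 != 0%R) ->
      #|[set j in S | e i j && ((k0 + k1 * t j + k2 * u j)%R == 0%R)]| <= k)%N ->
    (forall i j, e i j = e j i) ->
  (\sum_(i in S) #|[set j in S | e i j]| <= 2 * (15 * b + k) * #|S|)%N.
Proof.
move=> ltSb char_b ne_t eq_v cross_inj col e_sym.
have [F [F0 szF Fv]] := exists_vanishing ltSb.
suff: forall n (S' : {set T}), S' \subset S -> #|S'| = n ->
    (\sum_(i in S') #|[set j in S' | e i j]| <= 2 * (15 * b + k) * n)%N by apply.
elim=> [|n IH] S' sS cS.
  by rewrite muln0 (cards0_eq cS) big_set0.
have S0 : S' != set0 by rewrite -card_gt0 cS.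
have [|||i iS deg_i] := @sparse_vertex S' F (3 * b) k _ ne_t eq_v cross_inj _ S0 F0 szF.
- by move=> m; rewrite mulnA; apply: char_b.
- move=> i k0 k1 k2 iS nz; apply: leq_trans (col i k0 k1 k2 (subsetP sS _ iS) nz).
  apply/subset_leq_card/subsetP => j; rewrite !inE => /andP[jS ->].
  by rewrite (subsetP sS).
- by move=> i iS; apply/Fv/(subsetP sS).
rewrite (bigD1 i) //=.
have cS' : #|S' :\ i| = n by move: cS; rewrite (cardsD1 i) iS => -[].
have := IH (S' :\ i) (subset_trans (subsetDl _ _) sS) cS'.
rewrite [X in (X <= _)%N -> _](eq_bigl (fun j => (j \in S') && (j != i))); last first.
  by move=> j; rewrite !inE andbC.
move=> {}IH.
have -> : (\sum_(j in S' | j != i) #|[set l in S' | e j l]| =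
    \sum_(j in S' | j != i) #|[set l in S' :\ i | e j l]| + \sum_(j in S' | j != i) e i j)%N.
  rewrite -big_split /=; apply: eq_bigr => j /andP[jS ne_ji].
  rewrite (cardsD1 i) inE iS /= e_sym addnC; congr (_ + _)%N.
  by apply: eq_card => l; rewrite !inE andbA.
have : (\sum_(j in S' | j != i) e i j <= #|[set j in S' | e i j]|)%N.
  rewrite -sum1_card [X in (_ <= X)%N](eq_bigl (fun j => (j \in S') && e i j)); last first.
    by move=> j; rewrite inE.
  rewrite [X in (_ <= X)%N]big_mkcondr /= [X in (_ <= X)%N](bigID (fun j => j != i)) /=.
  by rewrite (leq_trans _ (leq_addr _ _)) //; apply: leq_sum => j _; case: e.
rewrite mulnS; move: IH deg_i; move: (2 * _ * n)%N => z; lia.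
Qed.
End Incidence.

(** * From point-plane incidences to crossings of isotropic lines *)

(** With v = w + u t, meeting is governed by an alternating bilinear form in the vectors (1, t, u,
    w); this is what lets a bilinear incidence equation be read as a crossing. *)
Lemma isotropic_cross (K : fieldType) (ti tj ui uj wi wj : K) :
    tj != ti -> wi - wj + uj * ti - ui * tj = 0 ->
  wi + ui * ti + ti ^+ 2 * ((uj - ui) / (ti - tj)) =
  wj + uj * tj + tj ^+ 2 * ((uj - ui) / (ti - tj)).
Proof.
move=> ne om; have d0 : ti - tj != 0 by rewrite subr_eq0 eq_sym.
apply/eqP; rewrite -subr_eq0 -[X in _ == X]om; apply/eqP; field.
exact: d0.
Qed.

Lemma cross_isotropic (K : comPzRingType) (tj tl uj ul wj wl s : K) :
    uj + tj * s = ul + tl * s ->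
    wj + uj * tj + tj ^+ 2 * s = wl + ul * tl + tl ^+ 2 * s ->
  wj - wl + ul * tj - uj * tl = 0.
Proof.
move=> eu ev.
transitivity ((wj + uj * tj + tj ^+ 2 * s) - (wl + ul * tl + tl ^+ 2 * s) -
  (tj + tl) * ((uj + tj * s) - (ul + tl * s))); first by ring.
by rewrite eu ev !subrr mulr0 subrr.
Qed.

Section Generic.
Variable F : fieldType.
Notation K := {fraction {poly F}}.
(* Constants are embedded in F(X): the transcendental [gen] puts the two
   families of lines in general position, so that lines of the same family
   never cross. *)
Definition cst (c : F) : K := tofrac c%:P.
Definition gen : K := tofrac 'X.

HB.instance Definition _ := GRing.RMorphism.copy cst (@tofrac {poly F} \o @polyC F).

Lemma gen_free c0 c1 c2 c3 :
    cst c0 + cst c1 * gen + cst c2 * gen ^+ 2 + cst c3 * gen ^+ 3 = 0 ->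
  [/\ c0 = 0, c1 = 0, c2 = 0 & c3 = 0].
Proof.
rewrite /cst /gen -!rmorphXn -!rmorphM -!rmorphD /= => /eqP.
rewrite tofrac_eq0 => /eqP eq0.
set q := (X in X = 0) in eq0.
have coefE i : q`_i = 0 by rewrite eq0 coef0.
move: (coefE 0%N) (coefE 1%N) (coefE 2%N) (coefE 3%N).
rewrite /q !coefD !coefCM !coefX !coefXn !coefC /=.
by rewrite !(mulr0, mulr1, addr0, add0r).
Qed.

End Generic.

Section Energy.
Variables (F : finFieldType) (A : {set F}) (L : {set F * F}).

Definition energy : nat :=
  \sum_(x in A) \sum_(l in L) \sum_(x' in A) \sum_(l' in L)
    (l'.1 * x + l'.2 == l.1 * x' + l.2)%R.

(* A pair (x, l) with x in A, l in L gives one line in each of the two families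
   distinguished by the boolean. *)
Let V : finType := (bool * (F * (F * F)))%type.
Let S : {set V} := [set i | (i.2.1 \in A) && (i.2.2 \in L)].
Variables (K : fieldType) (ce : {rmorphism F -> K}) (be : K).
Hypothesis be_free : forall c0 c1 c2 c3,
  ce c0 + ce c1 * be + ce c2 * be ^+ 2 + ce c3 * be ^+ 3 = 0 ->
  [/\ c0 = 0, c1 = 0, c2 = 0 & c3 = 0].
Let e : rel V := fun i j =>
  [&& i \in S, j \in S, i.1 != j.1 &
      j.2.2.1 * i.2.1 + j.2.2.2 == i.2.2.1 * j.2.1 + i.2.2.2].
(** Between the two families the factors be ^ 2 cancel in u t, and the multiples of be in w absorb
    the shift in t, so [om] becomes the incidence equation. Within a family distinct powers of be
    survive, so [om] = 0 splits into separate equations over F. *)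
Let t (i : V) : K := (ce i.2.1 + be) * (if i.1 then 1 else be ^+ 2).
Let u (i : V) : K := ce i.2.2.1 / (if i.1 then be ^+ 2 else 1).
Let w (i : V) : K := be * ce i.2.2.1 - ce i.2.2.2.
Let v (i : V) : K := w i + u i * t i.
Let om i j := w i - w j + u j * t i - u i * t j.

Let be0 : be != 0.
Proof.
apply/eqP => b0; have [|_ /eqP] := @be_free 0 1 0 0; last by rewrite oner_eq0.
by rewrite b0 !expr0n rmorph0 /=; ring.
Qed.

Let e_sym i j : e i j = e j i.
Proof. by apply/and4P/and4P => -[iS jS ne /eqP eq_ij]; split; rewrite // 1?eq_sym // eq_ij. Qed.

Let omE i j : i.1 = j.1 -> om i j = 0 ->
  i.2.2.2 = j.2.2.2 /\ i.2.2.1 = j.2.2.1 /\ j.2.2.1 * i.2.1 = i.2.2.1 * j.2.1.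
Proof.
rewrite /om /w /u /t => <-; case: i.1 => om0.
  have := @be_free (j.2.2.1 * i.2.1 - i.2.2.1 * j.2.1) (j.2.2.1 - i.2.2.1)
    (j.2.2.2 - i.2.2.2) (i.2.2.1 - j.2.2.1).
  case=> [|eqx eqm eqc _].
    rewrite !rmorphB !rmorphM; transitivity (be ^+ 2 * 0); last exact: mulr0.
    by rewrite -om0; field; exact: be0.
  by do ?split; apply: subr0_eq; rewrite // -opprB ?eqc ?eqm oppr0.
have := @be_free (j.2.2.2 - i.2.2.2) (i.2.2.1 - j.2.2.1)
  (j.2.2.1 * i.2.1 - i.2.2.1 * j.2.1) (j.2.2.1 - i.2.2.1).
case=> [|eqc eqm eqx _].
  by rewrite !rmorphB !rmorphM -[RHS]om0 !divr1; ring.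
by do ?split; apply: subr0_eq; rewrite // -opprB ?eqc ?eqm oppr0.
Qed.

Let om_e i j : e i j -> om i j = 0.
Proof.
case/and4P => _ _ ne /eqP inc.
have : ce (j.2.2.1 * i.2.1 + j.2.2.2) = ce (i.2.2.1 * j.2.1 + i.2.2.2).
  by rewrite inc.
rewrite /om /w /u /t !rmorphD !rmorphM /=; case: i.1 ne; case: j.1 => // _ h.
  transitivity ((ce j.2.2.1 * ce i.2.1 + ce j.2.2.2) - (ce i.2.2.1 * ce j.2.1 + ce i.2.2.2)).
    by rewrite !divr1; field; exact: be0.
  by rewrite h subrr.
transitivity ((ce j.2.2.1 * ce i.2.1 + ce j.2.2.2) - (ce i.2.2.1 * ce j.2.1 + ce i.2.2.2)).
  by rewrite !divr1; field; exact: be0.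
by rewrite h subrr.
Qed.

Let t_e i j : e i j -> t j != t i.
Proof.
case/and4P => _ _ ne _; apply/eqP => tE.
have abs x y : (ce x + be) * be ^+ 2 != ce y + be.
  apply/eqP => /eqP; rewrite -subr_eq0 => /eqP eq0.
  have [|_ /eqP] := @be_free (- y) (-1) x 1; last by rewrite oppr_eq0 oner_eq0.
  by rewrite rmorphN rmorphN1 rmorph1 -[RHS]eq0; ring.
move: tE; rewrite /t; case: i.1 ne; case: j.1 => // _ /eqP; rewrite mulr1.
  by rewrite (negPf (abs _ _)).
by rewrite eq_sym (negPf (abs _ _)).
Qed.

Hypothesis slope_neq0 : {in L, forall l, l.1 != 0}.

(** Lines j and l lie in the family opposite to that of i. Sharing a point, they satisfy [om] = 0,
    so [omE] gives equal lines of the plane and equal products of slope and x; a non-zero slope then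
    gives equal x. *)
Let cross_inj i j l : e i j -> e i l ->
  (u j - u i) / (t i - t j) = (u l - u i) / (t i - t l) -> j = l.
Proof.
move=> eij eil eqs; have tj := t_e eij; have tl := t_e eil.
have vj := isotropic_cross tj (om_e eij); have vl := isotropic_cross tl (om_e eil).
rewrite -eqs in vl; set s := _ / _ in eqs vj vl.
have uj : u j + t j * s = u i + t i * s.
  by rewrite /s; field; rewrite subr_eq0 eq_sym.
have ul : u l + t l * s = u i + t i * s.
  by rewrite eqs; field; rewrite subr_eq0 eq_sym.
have /omE := cross_isotropic (etrans uj (esym ul)) (etrans (esym vj) vl).
case/and4P: eij => _ jS bj _; case/and4P: eil => _ lS bl _.
have bE : j.1 = l.1 by case: i.1 bj bl; case: j.1; case: l.1.
case=> // c_eq [m_eq]; rewrite m_eq => /mulfI x_eq.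
case: j l c_eq m_eq x_eq lS bE {uj ul tj tl vj vl s eqs jS bj bl} =>
  [bj [xj [mj cj]]] [bl [xl [ml cl]]] /= -> -> x_eq.
rewrite inE /= => /andP[_ /slope_neq0 /= m0] ->.
by rewrite x_eq.
Qed.

Variable r : nat.
Hypothesis concurrent : forall x z, x \in A -> (#|[set l in L | (l.1 * x + l.2)%R == z]| <= r)%N.

(** If k2 = 0, the relation fixes x_j, and incidence makes the lines l_j concurrent at abscissa x_i,
    so there are at most r. Otherwise x_j determines the slope through u_j and then the intercept by
    incidence, so there are at most |A|. *)
Let collinear_le i k0 k1 k2 : i \in S -> (k1 != 0%R) || (k2 != 0%R) ->
  (#|[set j in S | e i j && ((k0 + k1 * t j + k2 * u j)%R == 0%R)]| <= #|A| + r)%N.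
Proof.
move=> iS; have xA : i.2.1 \in A by move: iS; rewrite inE => /andP[].
have scale_neq0 (b : bool) : (if b then 1 else be ^+ 2) != 0.
  by case: b; rewrite ?oner_neq0 // expf_neq0.
have [k20|k20 _] := eqVneq k2 0.
  rewrite orbF => k10; rewrite k20 (leq_trans _ (leq_addl _ _)) //.
  set J := [set _ in _ | _]; have [->|[j0 j0J]] := set_0Vmem J; first by rewrite cards0.
  have same_x j : j \in J -> j.1 = j0.1 /\ j.2.1 = j0.2.1.
    move: j0J; rewrite !inE => /and3P[_ /and4P[_ _ b0 _] /eqP eq0].
    case/and3P => _ /and4P[_ _ bj _] /eqP eqj.
    have bE : j.1 = j0.1 by case: i.1 b0 bj; case: j.1; case: j0.1.
    split=> //; have : t j = t j0.
      apply: (mulfI k10); move: eqj; rewrite -[RHS]eq0 !mul0r !addr0.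
      exact: addrI.
    by rewrite /t bE => /(mulIf (scale_neq0 _))/addIr/fmorph_inj.
  apply: leq_trans (concurrent (i.2.2.1 * j0.2.1 + i.2.2.2) xA).
  rewrite -(card_in_imset (f := fun j : V => j.2.2)) => [|j l jJ lJ eql].
    apply/subset_leq_card/subsetP => _ /imsetP[j jJ ->].
    have [_ <-] := same_x j jJ; move: jJ; rewrite !inE.
    by case/and3P => /andP[_ ->] /and4P[_ _ _ ->].
  have [bj xj] := same_x j jJ; have [bl xl] := same_x l lJ.
  by rewrite [j]surjective_pairing [j.2]surjective_pairing bj xj eql -bl -xl -!surjective_pairing.
rewrite (leq_trans _ (leq_addr _ _)) //.
rewrite -(card_in_imset (f := fun j : V => j.2.1)) => [|j l].
  apply/subset_leq_card/subsetP => _ /imsetP[j + ->].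
  by rewrite !inE => /andP[/andP[]].
rewrite !inE => /and3P[_ /and4P[_ _ bj /eqP incj] /eqP eqj].
case/and3P => _ /and4P[_ _ bl /eqP incl] /eqP eql eqx.
have bE : j.1 = l.1 by case: i.1 bj bl; case: j.1; case: l.1.
have tE : t j = t l by rewrite /t bE eqx.
have m_eq : j.2.2.1 = l.2.2.1.
  have : u j = u l.
    apply: (mulfI k20); move: eqj; rewrite -[RHS]eql tE; exact: addrI.
  rewrite /u bE => /(mulIf _) eqm; apply: (fmorph_inj ce); apply: eqm.
  by rewrite invr_eq0; case: l.1; rewrite ?oner_neq0 ?expf_neq0.
have c_eq : j.2.2.2 = l.2.2.2.
  apply: (addrI (j.2.2.1 * i.2.1)); rewrite incj m_eq incl eqx //.
case: j l {incj incl eqj eql bj bl tE} eqx bE m_eq c_eq => [bj [xj [mj cj]]] [bl [xl [ml cl]]] /=.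
by move=> -> -> -> ->.
Qed.

Lemma energy_le_of_free b :
    (6 * (#|A| * #|L|) < b ^ 2)%N -> (forall m, (0 < m <= 9 * b)%N -> m%:R != 0 :> F) ->
  (energy <= 4 * (15 * b + #|A| + r) * (#|A| * #|L|))%N.
Proof.
move=> lt_b char_b.
have cS : #|S| = (2 * (#|A| * #|L|))%N.
  rewrite -card_bool -cardsX -cardsT -cardsX; apply: eq_card => -[b' [x l]].
  by rewrite !inE.
have sumS (f : V -> nat) :
    (\sum_(x in A) \sum_(l in L) f (true, (x, l)) <= \sum_(i in S) f i)%N /\
    (\sum_(x in A) \sum_(l in L) f (false, (x, l)) <= \sum_(i in S) f i)%N.
  have -> : (\sum_(i in S) f i = \sum_b \sum_(x in A) \sum_(l in L) f (b, (x, l)))%N.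
    under [RHS]eq_bigr => b' _ do rewrite pair_big.
    by rewrite pair_big_dep; apply: eq_big => [[b' [x l]]|[b' [x l]] _] //; rewrite inE.
  by rewrite big_bool; split; rewrite ?leq_addr ?leq_addl.
(* The energy counts only the pairs with i in the family [false] and j in the family [true]. *)
have le_e : (energy <= \sum_(i in S) #|[set j in S | e i j]|)%N.
  apply: leq_trans (sumS (fun i => #|[set j in S | e i j]|)).2.
  apply: leq_sum => x xA; apply: leq_sum => l lL.
  have -> : #|[set j in S | e (false, (x, l)) j]| = (\sum_(j in S) e (false, (x, l)) j)%N.
    by rewrite -big_mkcondr sum1dep_card.
  apply: leq_trans (sumS (fun j => e (false, (x, l)) j : nat)).1.
  apply: leq_sum => x' x'A; apply: leq_sum => l' l'L.
  by rewrite /e !inE /= xA lL x'A l'L.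
apply: leq_trans le_e _.
have -> : (4 * (15 * b + #|A| + r) * (#|A| * #|L|) = 2 * (15 * b + (#|A| + r)) * #|S|)%N.
  by rewrite cS; ring.
apply: (@edge_bound K V e t u v) => //.
- by rewrite cS; apply: leq_ltn_trans lt_b; lia.
- move=> m m_b; rewrite -(rmorph_nat ce) fmorph_eq0.
  exact: char_b.
- by move=> i j eij; apply: isotropic_cross (t_e eij) (om_e eij).
Qed.
End Energy.

Lemma energy_le (F : finFieldType) (A : {set F}) (L : {set F * F}) r b :
    {in L, forall l, l.1 != 0} ->
    (forall x z, x \in A -> #|[set l in L | (l.1 * x + l.2)%R == z]| <= r)%N ->
    (6 * (#|A| * #|L|) < b ^ 2)%N -> (forall m, (0 < m <= 9 * b)%N -> m%:R != 0 :> F) ->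
  (energy A L <= 4 * (15 * b + #|A| + r) * (#|A| * #|L|))%N.
Proof. by move=> L0 conc; apply: energy_le_of_free (@gen_free F) L0 _ conc _. Qed.

(** * Elementary inequalities for the rich-line estimate *)

Section NatBounds.
Local Open Scope nat_scope.

Lemma sum_sqr_le (T : finType) (B : {set T}) (f : T -> nat) :
  (\sum_(z in B) f z) ^ 2 <= #|B| * \sum_(z in B) f z ^ 2.
Proof.
rewrite -(@leq_pmul2l 2) // -mulnn big_distrlr /= big_distrr /=.
apply: (@leq_trans (\sum_(i in B) \sum_(j in B) (f i ^ 2 + f j ^ 2))).
  by apply: leq_sum => i _; rewrite big_distrr /=; apply: leq_sum => j _; apply: nat_Cauchy.
under eq_bigr => i _ do rewrite big_split /= sum_nat_const.
by rewrite big_split /= sum_nat_const -big_distrr /= -mulnDr addnn -mul2n mulnCA.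
Qed.

Lemma subset_of_card (T : finType) (B : {set T}) m :
  m <= #|B| -> exists2 C : {set T}, C \subset B & #|C| = m.
Proof.
move=> le_m; exists [set x in take m (enum B)].
  by apply/subsetP => x; rewrite inE => /mem_take; rewrite mem_enum.
rewrite cardsE; have /card_uniqP -> : uniq (take m (enum B)) by rewrite take_uniq ?enum_uniq.
by rewrite size_takel // -cardE.
Qed.

(** This contradicts the two bounds on the energy of M rich lines. Each of the three summands on the
    left is less than a third of k ^ 2 * M. *)
Lemma rich_arith n k M b r : k <= n -> 0 < M -> 900 ^ 2 * n ^ 5 < M * k ^ 4 ->
    b ^ 2 <= 24 * (n * M) -> r * k <= 2 * n ^ 2 ->
  4 * n ^ 2 * (15 * b + n + r) < k ^ 2 * M.
Proof.
move=> le_kn M0 lt_M le_b le_r.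
have k0 : 0 < k by case: k lt_M {le_kn le_r} => //; rewrite exp0n // muln0.
have n0 : 0 < n by apply: leq_trans le_kn.
set X := k ^ 2 * M.
have XE : X * k ^ 2 = M * k ^ 4 by rewrite /X mulnAC -expnD mulnC.
have X1 : 900 ^ 2 * n ^ 3 < X.
  rewrite -(@ltn_pmul2r (k ^ 2)) ?expn_gt0 ?k0 // XE (leq_ltn_trans _ lt_M) //.
  by rewrite -mulnA (expnD n 3 2) !leq_mul2l leq_exp2r // le_kn !orbT.
have X2 : 900 ^ 2 * n ^ 4 < X * k.
  rewrite -(@ltn_pmul2r k) // -[X * k * k]mulnA mulnn XE (leq_ltn_trans _ lt_M) //.
  by rewrite -mulnA [n ^ 5]expnSr !leq_mul2l le_kn !orbT.
have X3 : 900 ^ 2 * n ^ 5 * M < X ^ 2.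
  by rewrite (_ : X ^ 2 = M * k ^ 4 * M) ?ltn_pmul2r // /X; ring.
have h1 : 12 * n ^ 3 < X.
  by move: X1; move: (n ^ 3) => z; lia.
have h2 : 12 * n ^ 2 * r < X.
  rewrite -(@ltn_pmul2r k) // (leq_ltn_trans _ X2) // -mulnA.
  apply: (@leq_trans (12 * n ^ 2 * (2 * n ^ 2))); first by rewrite leq_mul2l le_r orbT.
  by rewrite (expnD n 2 2); move: (n ^ 2) => z; lia.
(* The constant 900 comes from here: 180 ^ 2 * 24 <= 900 ^ 2. *)
have h3 : 180 * n ^ 2 * b < X.
  rewrite -(@ltn_exp2r _ _ 2) // (leq_ltn_trans _ X3) //.
  rewrite (_ : (180 * n ^ 2 * b) ^ 2 = 180 ^ 2 * n ^ 4 * b ^ 2); last by ring.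
  apply: (@leq_trans (180 ^ 2 * n ^ 4 * (24 * (n * M)))); first by rewrite leq_mul2l le_b orbT.
  by rewrite (expnSr n 4); move: (n ^ 4) => y; lia.
lia.
Qed.

(** * Lines rich in points of A x A *)
End NatBounds.

Section RichLines.
Local Open Scope nat_scope.
Variables (F : finFieldType) (A : {set F}).

(* A pair l = (m, c) stands for the non-vertical line y = m x + c. *)
Definition inc (l : F * F) : nat := #|[set x in A | (l.1 * x + l.2)%R \in A]|.

(** Horizontal lines are left out because the energy bound requires non-zero slopes; their
    contribution is summed directly. *)
Definition rich k : {set F * F} := [set l | (l.1 != 0%R) && (k <= inc l)].

Lemma inc_le l : inc l <= #|A|.
Proof. by apply/subset_leq_card/subsetP => x; rewrite inE => /andP[]. Qed.

(** Each such line has at least k - 1 points of A x A off the abscissa x, and no two of these lines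
    share one, since they already meet at (x, z). *)
Lemma concurrent_rich k x z : x \in A ->
  #|[set l in rich k | (l.1 * x + l.2)%R == z]| * k.-1 <= #|A| ^ 2.
Proof.
move=> xA; set J := [set _ in _ | _].
apply: (@leq_trans (\sum_(l in J) \sum_(P in setX A A)
  ((P.1 != x) && ((l.1 * P.1 + l.2)%R == P.2)))).
  rewrite -sum_nat_const; apply: leq_sum => l; rewrite !inE => /andP[/andP[_ kl] _].
  have le1 : k.-1 <= #|[set x' in A | (l.1 * x' + l.2)%R \in A] :\ x|.
    by rewrite -subn1 leq_subLR (leq_trans kl) // /inc (cardsD1 x) leq_add2r leq_b1.
  apply: leq_trans le1 _; rewrite -big_mkcondr sum1dep_card.
  rewrite -(card_imset _ (_ : injective (fun x' => (x', l.1 * x' + l.2)%R))); last by move=> ? ? [].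
  apply/subset_leq_card/subsetP => _ /imsetP[x' + ->].
  by rewrite !inE /= => /and3P[-> -> ->]; rewrite eqxx.
rewrite exchange_big /= -mulnn -cardsX -[X in _ <= X]muln1 -sum_nat_const.
apply: leq_sum => -[x' y] _ /=; rewrite -big_mkcondr sum1dep_card.
apply/card_le1_eqP => -[m c] [m' c']; rewrite !inE /=.
move=> /and3P[/andP[_ /eqP lx] ne /eqP ly] /and3P[/andP[_ /eqP lx'] _ /eqP ly'].
have em : m' = m.
  have d0 : (x' - x != 0)%R by rewrite subr_eq0.
  apply: (mulIf d0); apply/eqP; rewrite -subr_eq0; apply/eqP.
  transitivity ((m' * x' + c') - (m' * x + c') - ((m * x' + c) - (m * x + c)))%R; first by ring.
  by rewrite lx lx' ly ly' subrr.
by congr pair => //; apply: (addrI (m * x)%R); rewrite lx -{1}em lx'.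
Qed.

(** Cauchy-Schwarz over the values z in A, with N z the number of pairs (x, l) such that l(x) = z:
    these numbers add up to at least k |L|, and their squares to at most the energy. *)
Lemma energy_ge k (L : {set F * F}) : L \subset rich k ->
  (k * #|L|) ^ 2 <= #|A| * energy A L.
Proof.
move=> sL; pose N z := \sum_(x in A) \sum_(l in L) ((l.1 * x + l.2)%R == z).
apply: (@leq_trans ((\sum_(z in A) N z) ^ 2)).
  rewrite leq_exp2r // /N exchange_big /=.
  under eq_bigr => x _ do rewrite exchange_big /=.
  rewrite exchange_big /= mulnC -sum_nat_const; apply: leq_sum => l /(subsetP sL).
  rewrite inE => /andP[_ /leq_trans]; apply; rewrite /inc -sum1dep_card big_mkcondr /=.
  apply: leq_sum => x xA; case: ifP => // lxA.
  by rewrite (bigD1 (l.1 * x + l.2)%R) //= eqxx.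
apply: leq_trans (sum_sqr_le _ _) _; rewrite leq_mul2l; apply/orP; right.
have -> : energy A L = \sum_(x in A) \sum_(l' in L) \sum_(x' in A) \sum_(l in L)
    ((l'.1 * x + l'.2)%R == (l.1 * x' + l.2)%R).
  rewrite /energy; apply: eq_bigr => x _; rewrite exchange_big /= [RHS]exchange_big /=.
  by apply: eq_bigr => x' _; rewrite exchange_big.
have -> : \sum_(z in A) N z ^ 2 = \sum_(x in A) \sum_(l' in L) \sum_(x' in A) \sum_(l in L)
    \sum_(z in A) ((l'.1 * x + l'.2)%R == z) * ((l.1 * x' + l.2)%R == z).
  under eq_bigr => z _ do rewrite -mulnn [N z * N z]big_distrl /=.
  rewrite exchange_big /=; apply: eq_bigr => x _.
  under eq_bigr => z _ do rewrite big_distrl /=.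
  rewrite exchange_big /=; apply: eq_bigr => l' _.
  under eq_bigr => z _ do rewrite big_distrr /=.
  rewrite exchange_big /=; apply: eq_bigr => x' _.
  under eq_bigr => z _ do rewrite big_distrr /=.
  by rewrite exchange_big.
apply: leq_sum => x _; apply: leq_sum => l' _; apply: leq_sum => x' _; apply: leq_sum => l _.
set a := (_ + _)%R; set b := (_ + _)%R; have [<-|ne_ab] := eqVneq a b.
  apply: (@leq_trans (\sum_(z in A) (a == z))).
    by apply: leq_sum => z _; case: (a == z).
  rewrite -big_mkcondr sum1dep_card; apply/card_le1_eqP => z z'.
  by rewrite !inE => /andP[_ /eqP<-] /andP[_ /eqP<-].
by rewrite big1 // => z _; case: eqP => // <-; rewrite eq_sym (negPf ne_ab).
Qed.

(* The constants satisfy 81 * 24 * (900 ^ 2 + 1) < 201 ^ 4, which makes the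
   degree of the interpolating polynomial smaller than the characteristic. *)
Lemma rich_le k : (forall m, 0 < m < #|F| -> (m%:R != 0 :> F)%R) -> 2 <= k ->
  201 ^ 2 * #|A| ^ 3 <= k ^ 2 * #|F| -> #|rich k| * k ^ 4 <= 900 ^ 2 * #|A| ^ 5.
Proof.
set n := #|A|; set p := #|F|; move=> char_p k2 le_kp; rewrite leqNgt; apply/negP => lt_rich.
have k4 : 0 < k ^ 4 by rewrite expn_gt0 (ltnW k2).
have le_kn : k <= n.
  have : 0 < #|rich k| by case: #|rich k| lt_rich.
  by rewrite card_gt0 => /set0Pn[l]; rewrite inE => /andP[_ /leq_trans]; apply; apply: inc_le.
have n0 : 0 < n by apply: leq_trans le_kn; apply: leq_trans k2.
(* The least number of lines violating the bound. Keeping exactly M of them keeps the degree of the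
   interpolating polynomial small. *)
pose M := (900 ^ 2 * n ^ 5 %/ k ^ 4).+1.
have lt_M : 900 ^ 2 * n ^ 5 < M * k ^ 4 by rewrite -ltn_divLR.
have le_M : M * k ^ 4 <= (900 ^ 2).+1 * n ^ 5.
  rewrite mulSn addnC /M mulSn addnC leq_add ?leq_trunc_div //.
  by rewrite (@leq_trans (n ^ 4)) ?leq_exp2r // leq_pexp2l.
have [L sL cL] : exists2 L : {set F * F}, L \subset rich k & #|L| = M.
  by apply: subset_of_card; rewrite ltn_divLR.
have nM0 : 0 < n * M by rewrite muln_gt0 n0.
(* For the least b satisfying the first inequality, the second follows from b <= 2 (b - 1). *)
have [b lt_b le_b] : exists2 b, 6 * (n * M) < b ^ 2 & b ^ 2 <= 24 * (n * M).
  have ex_b : exists b, 6 * (n * M) < b ^ 2.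
    by exists (6 * (n * M)).+1; rewrite -mulnn; nia.
  case: (ex_minnP ex_b) => b lt_b min_b; exists b => //.
  have b_gt1 : 1 < b by rewrite ltnNge; apply/negP => b1; move: lt_b nM0; nia.
  have : b.-1 ^ 2 <= 6 * (n * M).
    rewrite leqNgt; apply/negP => /min_b; rewrite leqNgt => /negP[].
    by rewrite prednK // ltnW.
  by rewrite -!mulnn; nia.
have lt_bp : 9 * b < p.
  rewrite -(@ltn_exp2r _ _ 2) // -(@ltn_pmul2r (k ^ 4)) //.
  have h1 : (9 * b) ^ 2 * k ^ 4 <= 1944 * (n * (M * k ^ 4)).
    by rewrite expnMn; move: le_b; move: (b ^ 2) (k ^ 4) => y z; nia.
  have h2 : 1944 * (n * (M * k ^ 4)) <= 1944 * ((900 ^ 2).+1 * n ^ 6).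
    by move: le_M; rewrite (expnS n 5); move: (n ^ 5) (M * k ^ 4) => y z; nia.
  have h3 : (201 ^ 2 * n ^ 3) ^ 2 <= p ^ 2 * k ^ 4.
    have -> : p ^ 2 * k ^ 4 = (k ^ 2 * p) ^ 2 by rewrite expnMn -expnM mulnC.
    by rewrite leq_exp2r.
  apply: leq_ltn_trans h1 _; apply: leq_ltn_trans h2 _; apply: leq_trans h3.
  rewrite expnMn -[(n ^ 3) ^ 2]expnM.
  have : 0 < n ^ (3 * 2) by rewrite expn_gt0 n0.
  by move: (n ^ (3 * 2)) => y; lia.
(* The concurrency bound from [concurrent_rich]; k <= 2 (k - 1) turns it into r k <= 2 n ^ 2. *)
pose r := n ^ 2 %/ k.-1.
have k1 : 0 < k.-1 by case: (k) k2 => [|[]].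
have le_r : r * k <= 2 * n ^ 2.
  have := leq_trunc_div (n ^ 2) k.-1; rewrite -/r; move: (n ^ 2) => z.
  by move: k2; case: (k) => [|[|k']] //=; nia.
have conc x z : x \in A -> #|[set l in L | (l.1 * x + l.2)%R == z]| <= r.
  move=> xA; rewrite leq_divRL // (leq_trans _ (concurrent_rich k z xA)) // leq_mul2r.
  apply/orP; right; apply/subset_leq_card/subsetP => l; rewrite !inE => /andP[/(subsetP sL)].
  by rewrite inE => -> ->.
have slope l : l \in L -> (l.1 != 0)%R by move/(subsetP sL); rewrite inE => /andP[].
have := energy_le slope conc; rewrite -/n cL => /(_ b lt_b) le_E.
have {le_E} le_E : energy A L <= 4 * (15 * b + n + r) * (n * M).
  apply: le_E => m /andP[m0 mb]; apply: char_p; rewrite m0 /=.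
  exact: leq_ltn_trans lt_bp.
have := energy_ge sL; rewrite cL -/n => ge_E.
have := rich_arith le_kn (ltn0Sn _ : 0 < M) lt_M le_b le_r; rewrite ltnNge => /negP; apply.
have nM' : 0 < M by [].
rewrite -(@leq_pmul2r M) // (_ : k ^ 2 * M * M = (k * M) ^ 2); last by rewrite -mulnA mulnn expnMn.
apply: leq_trans ge_E _; rewrite -/n.
apply: leq_trans (leq_mul (leqnn n) le_E) _.
by rewrite leq_eqVlt; apply/orP; left; apply/eqP; ring.
Qed.
End RichLines.

(** * Power sums of the richness over non-vertical lines *)

Section LineSums.
Local Open Scope nat_scope.
Variable F : finFieldType.
Implicit Types (P Q S : F * F) (l : F * F).

Definition on l P : bool := (l.1 * P.1 + l.2 == P.2)%R.

Definition through P Q S : {set F * F} := [set l | [&& on l P, on l Q & on l S]].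

(** The correction terms account for vertical lines, which pairs (m, c) do not represent, and for a
    triple of coincident points, through which |F| non-vertical lines pass. *)
Lemma card_through P Q S :
  #|through P Q S| + ((P.1 == Q.1) && (P.1 == S.1)) =
  collinear P Q S + #|F| * ((P == Q) && (P == S)).
Proof.
have two_pts (X Y Z : F * F) : X.1 != Y.1 -> #|through X Y Z| = collinear X Y Z.
  move=> neXY; have d0 : (Y.1 - X.1 != 0)%R by rewrite subr_eq0 eq_sym.
  pose m := ((Y.2 - X.2) / (Y.1 - X.1))%R; pose l0 := (m, X.2 - m * X.1)%R.
  have onXY l : on l X && on l Y = (l == l0).
    apply/andP/eqP => [[/eqP lX /eqP lY]|->]; last first.
      by rewrite /on /l0 /m /=; split; apply/eqP; field.
    have lm : l.1 = m.
      apply: (mulIf d0); rewrite /m divfK // -lX -lY; ring.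
    by rewrite [l]surjective_pairing /l0 -lX lm; congr pair; ring.
  have onZ : on l0 Z = collinear X Y Z.
    rewrite /on /collinear /l0 /m /=; apply/eqP/eqP => [<-|eqZ]; first by field.
    apply: (mulIf d0); transitivity ((Z.1 - X.1) * (Y.2 - X.2) + X.2 * (Y.1 - X.1))%R.
      by field.
    by rewrite -eqZ; ring.
  have -> : through X Y Z = if on l0 Z then [set l0] else set0.
    apply/setP => l; rewrite inE andbA onXY; case: ifP => oZ; rewrite !inE.
      by case: eqP => // ->.
    by case: eqP => // ->.
  by rewrite onZ; case: collinear; rewrite ?cards1 ?cards0.
have [eqPQ|nePQ] := eqVneq P.1 Q.1; last first.
  rewrite (two_pts _ _ _ nePQ) (_ : P == Q = false) ?muln0 //.
  by apply: contraNF nePQ => /eqP->.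
have [eqPS|nePS] := eqVneq P.1 S.1; last first.
  have -> : through P Q S = through P S Q.
    by apply/setP => l; rewrite !inE [on l Q && _]andbC.
  rewrite (two_pts _ _ _ nePS) (_ : P == S = false) ?andbF ?muln0.
    by rewrite /collinear eq_sym.
  by apply: contraNF nePS => /eqP->.
have -> : collinear P Q S by rewrite /collinear -eqPQ -eqPS !subrr !mul0r.
have [/andP[/eqP <- /eqP <-]|neq] := boolP ((P == Q) && (P == S)).
  rewrite muln1 addnC; congr (_ + _).
  have -> : through P P P = [set (m, P.2 - m * P.1)%R | m : F].
    apply/setP => l; rewrite inE !andbb; apply/eqP/imsetP => [lP|[m _ ->]] /=; last by ring.
    by exists l.1 => //; rewrite [l]surjective_pairing /= -lP; congr pair; ring.
  by rewrite card_imset // => m m' [].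
rewrite muln0 addn0 /= (_ : through P Q S = set0) ?cards0 //.
apply/setP => l; rewrite !inE; apply: contraNF neq => /and3P[/eqP lP /eqP lQ /eqP lS].
rewrite [P]surjective_pairing [Q]surjective_pairing [S]surjective_pairing !xpair_eqE.
by rewrite -lP -lQ -lS -eqPQ -eqPS !eqxx.
Qed.

Variable A : {set F}.
Let D := setX A A.

Lemma inc_sum l : inc A l = \sum_(P in D) on l P.
Proof.
rewrite -big_mkcondr sum1dep_card /inc.
rewrite -(card_imset _ (_ : injective (fun x => (x, l.1 * x + l.2)%R))); last by move=> ? ? [].
apply: eq_card => P; rewrite inE; apply/imsetP/andP => [[x + ->]|[PD /eqP lP]].
  by rewrite !inE /on /= => /andP[-> ->].
exists P.1; last by rewrite lP -surjective_pairing.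
by move: PD; rewrite !inE lP.
Qed.

Lemma card_on3 P Q S : \sum_l on l P * (on l Q * on l S) = #|through P Q S|.
Proof.
rewrite -sum1dep_card [RHS]big_mkcond; apply: eq_bigr => l _.
by do 3!case: (on _ _).
Qed.

Lemma sum_inc3_through :
  \sum_l inc A l ^ 3 = \sum_(P in D) \sum_(Q in D) \sum_(S in D) #|through P Q S|.
Proof.
transitivity (\sum_l \sum_(P in D) \sum_(Q in D) \sum_(S in D) on l P * (on l Q * on l S)).
  apply: eq_bigr => l _; rewrite !expnS expn0 muln1 inc_sum big_distrl /=.
  apply: eq_bigr => P _; rewrite big_distrl big_distrr /=; apply: eq_bigr => Q _.
  by rewrite big_distrr big_distrr.
rewrite exchange_big; apply: eq_bigr => P _; rewrite exchange_big; apply: eq_bigr => Q _.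
by rewrite exchange_big; apply: eq_bigr => S _; rewrite card_on3.
Qed.

Lemma sum_inc2_through : \sum_l inc A l ^ 2 = \sum_(P in D) \sum_(Q in D) #|through P Q Q|.
Proof.
transitivity (\sum_l \sum_(P in D) \sum_(Q in D) on l P * (on l Q * on l Q)).
  apply: eq_bigr => l _; rewrite !expnS expn0 muln1 inc_sum big_distrl /=.
  apply: eq_bigr => P _; rewrite big_distrr /=; apply: eq_bigr => Q _.
  by case: (on l Q); rewrite ?muln0.
rewrite exchange_big; apply: eq_bigr => P _; rewrite exchange_big; apply: eq_bigr => Q _.
exact: card_on3.
Qed.

Lemma sum_inc_through : \sum_l inc A l = \sum_(P in D) #|through P P P|.
Proof.
under eq_bigr => l _ do rewrite inc_sum.
rewrite exchange_big; apply: eq_bigr => P _; rewrite -card_on3.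
by apply: eq_bigr => l _; case: (on l P).
Qed.

Lemma cardD : #|D| = #|A| ^ 2.
Proof. by rewrite cardsX mulnn. Qed.

Lemma sum_fst P : P \in D -> \sum_(Q in D) (P.1 == Q.1) = #|A|.
Proof.
rewrite inE => /andP[PA _]; rewrite -big_mkcondr sum1dep_card.
rewrite -[RHS]mul1n -(cards1 P.1) -cardsX; apply: eq_card => Q.
by rewrite !inE [Q.1 == _]eq_sym; case: eqP => [<-|_]; rewrite ?PA ?andbT ?andbF.
Qed.

Lemma sum_eqP P : P \in D -> \sum_(Q in D) (P == Q) = 1.
Proof.
by move=> PD; rewrite (bigD1 P) //= eqxx big1 // => Q /andP[_]; rewrite eq_sym => /negPf->.
Qed.

Lemma sum_inc : \sum_l inc A l = #|F| * #|A| ^ 2.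
Proof.
rewrite sum_inc_through -cardD mulnC -sum_nat_const; apply: eq_bigr => P _.
have := card_through P P P; rewrite !eqxx /collinear eqxx /= muln1; lia.
Qed.

Lemma sum_inc2 : \sum_l inc A l ^ 2 + #|A| ^ 3 = #|A| ^ 4 + #|F| * #|A| ^ 2.
Proof.
rewrite sum_inc2_through.
have -> : #|A| ^ 3 = \sum_(P in D) \sum_(Q in D) (P.1 == Q.1).
  by rewrite (eq_bigr _ sum_fst) sum_nat_const cardD -expnSr.
have -> : #|A| ^ 4 = \sum_(P in D) \sum_(Q in D) 1.
  by rewrite sum_nat_const sum1_card cardD -expnD.
have -> : #|F| * #|A| ^ 2 = \sum_(P in D) \sum_(Q in D) #|F| * (P == Q).
  under eq_bigr => P PD do rewrite -big_distrr /= sum_eqP // muln1.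
  by rewrite sum_nat_const cardD mulnC.
rewrite -!big_split /=; apply: eq_bigr => P _; rewrite -!big_split /=; apply: eq_bigr => Q _.
have := card_through P Q Q; rewrite !andbb => ->.
by rewrite /collinear eqxx.
Qed.

Lemma collinear_triples_sum :
  collinear_triples A = \sum_(P in D) \sum_(Q in D) \sum_(S in D) collinear P Q S.
Proof.
rewrite /collinear_triples -sum1dep_card.
rewrite pair_big /= pair_big_dep /=.
rewrite big_mkcond [RHS]big_mkcond; apply: eq_bigr => -[[P Q] S] _ /=; rewrite -/D.
by case: (P \in D); case: (Q \in D); case: (S \in D); case: (collinear P Q S).
Qed.

(** [card_through] summed over all triples: |A| ^ 4 of them share an abscissa, and |A| ^ 2 consist
    of one repeated point. *)
Lemma sum_inc3 :
  \sum_l inc A l ^ 3 + #|A| ^ 4 = collinear_triples A + #|F| * #|A| ^ 2.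
Proof.
rewrite sum_inc3_through collinear_triples_sum.
have -> : #|A| ^ 4 = \sum_(P in D) \sum_(Q in D) \sum_(S in D) ((P.1 == Q.1) && (P.1 == S.1)).
  under eq_bigr => P PD.
    under eq_bigr => Q _ do 
      (under eq_bigr => S _ do rewrite -mulnb; rewrite -big_distrr /= sum_fst //).
    rewrite -big_distrl sum_fst //=; over.
  by rewrite sum_nat_const cardD mulnn -expnD.
have -> : #|F| * #|A| ^ 2 = \sum_(P in D) \sum_(Q in D) \sum_(S in D) #|F| * ((P == Q) && (P == S)).
  under eq_bigr => P PD.
    under eq_bigr => Q _ do 
      (under eq_bigr => S _ do rewrite -mulnb mulnA; rewrite -big_distrr /= sum_eqP // muln1).
    rewrite -big_distrr /= sum_eqP //= muln1; over.
  by rewrite sum_nat_const cardD mulnC.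
rewrite -!big_split /=; apply: eq_bigr => P _; rewrite -!big_split /=; apply: eq_bigr => Q _.
by rewrite -!big_split /=; apply: eq_bigr => S _; apply: card_through.
Qed.
End LineSums.

(** * Moments of the richness and the number of collinear triples *)

Section Moments.
Variables (R : realType) (F : finFieldType) (A : {set F}).
Variable C0 : nat.
Hypothesis richC : forall k, (2 <= k -> 201 ^ 2 * #|A| ^ 3 <= k ^ 2 * #|F| ->
  #|rich A k| * k ^ 4 <= C0 * #|A| ^ 5)%N.
Let n : R := #|A|%:R.
Let q : R := #|F|%:R.
Let i (l : F * F) : R := (inc A l)%:R.
Let T : R := (collinear_triples A)%:R.

Let n_ge0 : 0 <= n. Proof. exact: ler0n. Qed.
Let le_nq : n <= q. Proof. by rewrite ler_nat max_card. Qed.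
Let q_gt0 : 0 < q. Proof. by rewrite ltr0n; apply/card_gt0P; exists 0. Qed.

Let S1 : \sum_l i l = q * n ^+ 2.
Proof. by rewrite -natr_sum sum_inc natrM natrX. Qed.

Let S2 : \sum_l i l ^+ 2 = n ^+ 4 - n ^+ 3 + q * n ^+ 2.
Proof.
have /(congr1 (fun m => m%:R : R)) := sum_inc2 A; rewrite !natrD natrM !natrX natr_sum -/n -/q.
under eq_bigr => l _ do rewrite natrX.
by rewrite -/i => h; rewrite addrAC -h addrK.
Qed.

Let S3 : \sum_l i l ^+ 3 = T - n ^+ 4 + q * n ^+ 2.
Proof.
have /(congr1 (fun m => m%:R : R)) := sum_inc3 A; rewrite !natrD natrM !natrX natr_sum -/n -/q.
under eq_bigr => l _ do rewrite natrX.
by rewrite -/i -/T => h; rewrite addrAC -h addrK.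
Qed.

Lemma triples_ge : 0 <= T - n ^+ 6 / q.
Proof.
have [A0|A0] := posnP #|A|.
  by rewrite /n A0 expr0n /= mul0r subr0 ler0n.
have n1 : 1 <= n by rewrite ler1n.
have sq_sum (a b : R) : a ^+ 2 * \sum_l i l ^+ 3 - 2 * a * b * \sum_l i l ^+ 2 +
    b ^+ 2 * \sum_l i l = \sum_l i l * (a * i l - b) ^+ 2.
  by rewrite !mulr_sumr -sumrB -big_split /=; apply: eq_bigr => l _; ring.
have CS : (\sum_l i l ^+ 2) ^+ 2 <= (\sum_l i l) * (\sum_l i l ^+ 3).
  have S1_gt0 : 0 < \sum_l i l by rewrite S1 mulr_gt0 // exprn_gt0 // (lt_le_trans ltr01).
  set a := \sum_l i l in S1_gt0 *; set b := \sum_l i l ^+ 2; set c := \sum_l i l ^+ 3.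
  rewrite -subr_ge0 -(pmulr_rge0 _ S1_gt0).
  have -> : a * (a * c - b ^+ 2) = \sum_l i l * (a * i l - b) ^+ 2.
    by rewrite -sq_sum -/a -/b -/c; move: a b c {S1_gt0} => a b c; ring.
  by apply: sumr_ge0 => l _; rewrite mulr_ge0 ?ler0n ?sqr_ge0.
rewrite S1 S2 S3 in CS.
rewrite subr_ge0 ler_pdivrMr //.
have n8 : 0 < n ^+ 2 by rewrite exprn_gt0 // (lt_le_trans ltr01).
rewrite -(ler_pM2l n8) -subr_ge0.
(* The slack left by Cauchy-Schwarz, non-negative because 1 <= n <= q. *)
apply: le_trans (_ : 0 <= n ^+ 5 * ((2 * n - 1) * (q - n) + q * (n - 1))) _.
  by rewrite mulr_ge0 ?exprn_ge0 // addr_ge0 // mulr_ge0 //; move: n1 le_nq q_gt0; lra.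
rewrite -subr_ge0; move: CS; rewrite -subr_ge0; congr (_ <= _); ring.
Qed.

Let X k : nat := (\sum_(l | (l.1 != 0%R) && (k <= inc A l)) inc A l ^ 3)%N.

(** The factor 4 is 1 + 3: the boundary term k ^ 3 |rich k| gives 1, and the sum over m > k of 3 m ^
    2 |rich m| gives 3. *)
Let X_le k : (2 <= k)%N -> (201 ^ 2 * #|A| ^ 3 <= k ^ 2 * #|F|)%N ->
  (X k)%:R * k%:R <= 4 * C0%:R * n ^+ 5.
Proof.
have X_step m : (X m + m ^ 3 * #|rich A m.+1| = X m.+1 + m ^ 3 * #|rich A m|)%N.
  pose E := (\sum_(l : F * F | (l.1 != 0%R) && (inc A l == m)) m ^ 3)%N.
  have -> : X m = (E + X m.+1)%N.
    rewrite /X (bigID (fun l => inc A l == m)) /=; congr (_ + _)%N.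
      apply: eq_big => [l|l /andP[_ /eqP-> //]].
      by rewrite -andbA; congr (_ && _); case: eqP => [->|_]; rewrite ?leqnn ?andbF.
    by apply: eq_bigl => l; rewrite -andbA; congr (_ && _); rewrite ltn_neqAle andbC eq_sym.
  have -> : (m ^ 3 * #|rich A m| = E + m ^ 3 * #|rich A m.+1|)%N.
    have cE k' : (m ^ 3 * #|rich A k'| = \sum_(l | l \in rich A k') m ^ 3)%N.
      by rewrite sum_nat_const mulnC.
    rewrite !cE (bigID (fun l => inc A l == m)) /=; congr (_ + _)%N.
      apply: eq_bigl => l; rewrite inE.
      by rewrite -andbA; congr (_ && _); case: eqP => [->|_]; rewrite ?leqnn ?andbF.
    by apply: eq_bigl => l; rewrite !inE -andbA; congr (_ && _); rewrite ltn_neqAle andbC eq_sym.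
  lia.
have rich_step m : (2 <= m)%N -> (201 ^ 2 * #|A| ^ 3 <= m ^ 2 * #|F|)%N ->
    (#|rich A m|)%:R * m%:R ^+ 4 <= C0%:R * n ^+ 5 :> R.
  by move=> m2 mF; have := richC m2 mF; rewrite -(ler_nat R) 2!natrM !natrX.
(* Summation by parts, as a downward induction on k. *)
suff: forall d k, (#|A| < k + d)%N -> (2 <= k)%N -> (201 ^ 2 * #|A| ^ 3 <= k ^ 2 * #|F|)%N ->
    (X k)%:R <= k%:R ^+ 3 * #|rich A k|%:R + 3 * C0%:R * n ^+ 5 / k%:R :> R.
  move=> claim k2 kF; have k0 : 0 < k%:R :> R by rewrite ltr0n (ltnW k2).
  have /(claim _ k)/(_ k2 kF) : (#|A| < k + #|A|.+1)%N by rewrite addnS ltnS leq_addl.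
  move=> h; apply: (le_trans 
    (y := (k%:R ^+ 3 * #|rich A k|%:R + 3 * C0%:R * n ^+ 5 / k%:R) * k%:R)).
    by rewrite ler_pM2r.
  rewrite mulrDl divfK ?gt_eqF // (_ : 4 * _ * _ = C0%:R * n ^+ 5 + 3 * C0%:R * n ^+ 5); last by ring.
  by rewrite lerD2r (le_trans _ (rich_step _ k2 kF)) // le_eqVlt; apply/orP; left; apply/eqP; ring.
elim=> [|d IH] {}k lt_nk k2 kF; have k0 : 0 < k%:R :> R by rewrite ltr0n (ltnW k2).
  rewrite addn0 in lt_nk; rewrite /X big_pred0 => [|l].
    by rewrite addr_ge0 ?divr_ge0 ?mulr_ge0 ?exprn_ge0 // ?ler0n ?ltW.
  by rewrite leqNgt (leq_ltn_trans (inc_le A l) lt_nk) andbF.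
have kF' : (201 ^ 2 * #|A| ^ 3 <= k.+1 ^ 2 * #|F|)%N.
  by rewrite (leq_trans kF) // leq_mul2r leq_exp2r // leqnSn orbT.
have := IH k.+1; rewrite addSnnS => /(_ lt_nk (ltnW k2) kF') IHk.
have stepR := congr1 (fun m => m%:R : R) (X_step k).
rewrite 2!natrD 2!natrM !natrX in stepR.
have k'0 : 0 < k.+1%:R :> R by rewrite ltr0n.
have rich' : #|rich A k.+1|%:R <= C0%:R * n ^+ 5 / k.+1%:R ^+ 4 :> R.
  by rewrite ler_pdivlMr ?exprn_gt0 // rich_step // ltnW.
set c := C0%:R * n ^+ 5; have c0 : 0 <= c by rewrite mulr_ge0 ?exprn_ge0 ?ler0n.
rewrite -[3 * C0%:R * _]mulrA -/c in IHk *; rewrite -/c in rich'.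
have kS : k.+1%:R = k%:R + 1 :> R by rewrite -natr1.
(* Telescoping: 1 / (k + 1) ^ 2 <= 1 / k - 1 / (k + 1). *)
have tele : 3 * k.+1%:R ^+ 2 * (c / k.+1%:R ^+ 4) + 3 * c / k.+1%:R <= 3 * c / k%:R.
  rewrite -subr_ge0 kS.
  have -> : 3 * c / k%:R - (3 * (k%:R + 1) ^+ 2 * (c / (k%:R + 1) ^+ 4) + 3 * c / (k%:R + 1))
     = 3 * c / (k%:R * (k%:R + 1) ^+ 2).
    by field; rewrite -kS !gt_eqF.
  by rewrite divr_ge0 ?mulr_ge0 ?exprn_ge0 // -kS ltW.
have cube : (k.+1%:R ^+ 3 - k%:R ^+ 3) * #|rich A k.+1|%:R <= 3 * k.+1%:R ^+ 2 * (c / k.+1%:R ^+ 4).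
  apply: ler_pM; rewrite ?ler0n //.
    by rewrite kS subr_ge0 lerXn2r ?nnegrE ?addr_ge0 ?lerDl // ltW.
  by rewrite kS; move: k0; nra.
rewrite mulrBl in cube; move: IHk stepR cube tele.
move: (k.+1%:R ^+ 3 * _) (k%:R ^+ 3 * _) (k%:R ^+ 3 * _) (3 * k.+1%:R ^+ 2 * _) (3 * c / _) (3 * c / _).
by move: (X k)%:R (X k.+1)%:R => *; lra.
Qed.

(** The mean of i over the q ^ 2 non-vertical lines. *)
Let mu : R := n ^+ 2 / q.

Let var_sum : \sum_l (i l - mu) ^+ 2 = q * n ^+ 2 - n ^+ 3.
Proof.
transitivity (\sum_l i l ^+ 2 - (mu *+ 2) * \sum_l i l + mu ^+ 2 * \sum_(l : F * F) 1).
  by rewrite !mulr_sumr -sumrB -big_split /=; apply: eq_bigr => l _; ring.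
rewrite S1 S2 sumr_const card_prod -/q natrM -/q /mu; field.
by rewrite gt_eqF.
Qed.

(** Centring at the mean absorbs the main term and leaves a weighted variance, to be compared with
    the variance in [var_sum]. *)
Let third_sum : T - n ^+ 6 / q =
  \sum_l i l * (i l - mu) ^+ 2 + 3 * n ^+ 4 - 2 * n ^+ 5 / q - q * n ^+ 2.
Proof.
have -> : \sum_l i l * (i l - mu) ^+ 2 =
    \sum_l i l ^+ 3 - (mu *+ 2) * \sum_l i l ^+ 2 + mu ^+ 2 * \sum_l i l.
  by rewrite !mulr_sumr -sumrB -big_split /=; apply: eq_bigr => l _; ring.
rewrite S1 S2 S3 /mu; field.
by rewrite gt_eqF.
Qed.

Let horizontal l : l.1 = 0 -> i l = if l.2 \in A then n else 0.
Proof.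
move=> l0; rewrite /i /inc l0; case: ifP => lA.
  by congr _%:R; apply: eq_card => x; rewrite inE mul0r add0r lA andbT.
rewrite (_ : [set _ in _ | _] = set0) ?cards0 //.
by apply/setP => x; rewrite !inE mul0r add0r lA andbF.
Qed.

(** A horizontal line contains n points if its height is in A and none otherwise. *)
Let sum_horizontal (f : R -> R) : f 0 = 0 ->
  \sum_(l | l.1 == 0) f (i l) = n * f n.
Proof.
move=> f0.
rewrite (reindex_onto (fun c : F => (0, c)) snd) => [|[m c] /= /eqP -> //].
rewrite (eq_bigl predT) => [|c]; last by rewrite /= !eqxx.
under eq_bigr => c _ do rewrite horizontal //.
rewrite (bigID (mem A)) /= [X in _ + X]big1 ?addr0 => [|c /negPf->//].
under eq_bigr => c cA do rewrite cA.
by rewrite sumr_const -mulr_natl.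
Qed.

Let q_ge0 : 0 <= q. Proof. exact: ltW. Qed.

Let mu_ge0 : 0 <= mu. Proof. by rewrite divr_ge0 // exprn_ge0. Qed.

Let mu_le : mu <= n.
Proof. by rewrite ler_pdivrMr // expr2 ler_wpM2l. Qed.

(** The weighted variance is split in three: horizontal lines give at most n ^ 4, lines with i >= k
    at most X k because 0 <= i - mu <= i there, and the others at most k times the variance. *)
Lemma triples_le_large k : (2 <= k)%N -> (201 ^ 2 * #|A| ^ 3 <= k ^ 2 * #|F|)%N ->
  T - n ^+ 6 / q <= 4 * n ^+ 4 + (k%:R - 1) * q * n ^+ 2 + 4 * C0%:R * n ^+ 5 / k%:R.
Proof.
move=> k2 kF; have k0 : 0 < k%:R :> R by rewrite ltr0n (ltnW k2).
(* mu ^ 2 = n ^ 4 / q ^ 2 <= n ^ 3 / q <= k ^ 2, using n <= q. *)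
have mu_k : mu <= k%:R.
  rewrite -(@ler_pXn2r _ 2) ?nnegrE ?ler0n //.
  rewrite /mu expr_div_n ler_pdivrMr ?exprn_gt0 //.
  have : n ^+ 3 <= k%:R ^+ 2 * q.
    have : (#|A| ^ 3 <= k ^ 2 * #|F|)%N by apply: leq_trans kF; rewrite leq_pmull.
    by rewrite -(ler_nat R) natrM !natrX.
  move=> h; rewrite -exprM (_ : n ^+ (2 * 2) = n ^+ 4) //.
  apply: (@le_trans _ _ (n ^+ 3 * q)); first by rewrite exprSr ler_wpM2l ?exprn_ge0.
  by rewrite expr2 mulrA ler_wpM2r // ltW.
have Xk : (X k)%:R <= 4 * C0%:R * n ^+ 5 / k%:R by rewrite ler_pdivlMr // X_le.
have XE : (X k)%:R = \sum_(l | (l.1 != 0) && (k <= inc A l)%N) i l ^+ 3.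
  by rewrite /X natr_sum; apply: eq_bigr => l _; rewrite natrX.
rewrite third_sum (bigID (fun l : F * F => l.1 == 0)) /=.
rewrite (sum_horizontal (f := fun x => x * (x - mu) ^+ 2)) ?mul0r //.
rewrite (bigID (fun l => (k <= inc A l)%N)) /=.
have h1 : n * (n * (n - mu) ^+ 2) <= n ^+ 4.
  rewrite (_ : n ^+ 4 = n * (n * n ^+ 2)); last by ring.
  rewrite ler_wpM2l // ler_wpM2l // lerXn2r ?nnegrE ?subr_ge0 //.
  by rewrite lerBlDr lerDl.
have h2 : \sum_(l | (l.1 != 0) && (k <= inc A l)%N) i l * (i l - mu) ^+ 2 <= (X k)%:R.
  rewrite XE; apply: ler_sum => l /andP[_ kl]; rewrite [i l ^+ 3]exprS ler_wpM2l ?ler0n //.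
  have mu_i : mu <= i l by rewrite (le_trans mu_k) // ler_nat.
  by rewrite lerXn2r ?nnegrE ?subr_ge0 ?ler0n // lerBlDr lerDl.
have h3 : \sum_(l : F * F | (l.1 != 0) && ~~ (k <= inc A l)%N) i l * (i l - mu) ^+ 2 <=
    k%:R * (q * n ^+ 2 - n ^+ 3).
  rewrite -var_sum mulr_sumr [X in _ <= X](bigID (fun l : F * F => (l.1 != 0) && ~~ (k <= inc A l)%N)) /=.
  rewrite ler_wpDr //; first by apply: sumr_ge0 => l _; rewrite mulr_ge0 ?sqr_ge0.
  apply: ler_sum => l /andP[_]; rewrite -ltnNge => /ltnW lk.
  by rewrite ler_wpM2r ?sqr_ge0 // ler_nat.
have h4 : 0 <= 2 * n ^+ 5 / q by rewrite divr_ge0 ?mulr_ge0 ?exprn_ge0 // ltW.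
have h5 : 0 <= k%:R * n ^+ 3 by rewrite mulr_ge0 ?exprn_ge0 ?ler0n.
move: h1 h2 h3 h4 h5 Xk; rewrite mulrBr mulrBl mul1r mulrBl -[k%:R * q * _]mulrA.
move: (\sum_(_ | _) _) (\sum_(_ | _) _) (X k)%:R (n * (n * _)) (k%:R * (_ * _)) (k%:R * _) (_ / q) (_ / k%:R).
by move=> *; lra.
Qed.

(** Here the main term is not subtracted. Summing i ^ 3 - i instead of i ^ 3 discards the lines with
    a single point, so no term q n ^ 2 appears. *)
Lemma triples_le_small k : (2 <= k)%N -> (201 ^ 2 * #|A| ^ 3 <= k ^ 2 * #|F|)%N ->
  T <= 2 * n ^+ 4 + k%:R * n ^+ 4 + 4 * C0%:R * n ^+ 5 / k%:R.
Proof.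
move=> k2 kF; have k0 : 0 < k%:R :> R by rewrite ltr0n (ltnW k2).
have Xk : (X k)%:R <= 4 * C0%:R * n ^+ 5 / k%:R by rewrite ler_pdivlMr // X_le.
have XE : (X k)%:R = \sum_(l | (l.1 != 0) && (k <= inc A l)%N) i l ^+ 3.
  by rewrite /X natr_sum; apply: eq_bigr => l _; rewrite natrX.
have TE : T = \sum_l (i l ^+ 3 - i l) + n ^+ 4.
  by rewrite sumrB S1 S3; ring.
rewrite TE (bigID (fun l : F * F => l.1 == 0)) /=.
rewrite (sum_horizontal (f := fun x => x ^+ 3 - x)) ?expr0n ?subr0 //.
rewrite (bigID (fun l => (k <= inc A l)%N)) /=.
have h2 : \sum_(l | (l.1 != 0) && (k <= inc A l)%N) (i l ^+ 3 - i l) <= (X k)%:R.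
  by rewrite XE; apply: ler_sum => l _; rewrite lerBlDr lerDl ler0n.
have h3 : \sum_(l : F * F | (l.1 != 0) && ~~ (k <= inc A l)%N) (i l ^+ 3 - i l) <= k%:R * n ^+ 4.
  apply: (@le_trans _ _ (k%:R * \sum_l (i l ^+ 2 - i l))).
    rewrite mulr_sumr [X in _ <= X](bigID (fun l : F * F => (l.1 != 0) && ~~ (k <= inc A l)%N)) /=.
    have pos l : 0 <= i l ^+ 2 - i l.
      by rewrite subr_ge0 /i -natrX ler_nat; case: (inc A l) => // m; rewrite -mulnn leq_pmulr.
    rewrite ler_wpDr //; first by apply: sumr_ge0 => l _; rewrite mulr_ge0 ?ler0n.
    apply: ler_sum => l /andP[_]; rewrite -ltnNge => lk.
    (* The factor i + 1 is at most k because i < k. *)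
    rewrite (_ : i l ^+ 3 - i l = (i l + 1) * (i l ^+ 2 - i l)); last by ring.
    by rewrite ler_wpM2r // natr1 ler_nat.
  rewrite ler_wpM2l ?ler0n // sumrB S1 S2.
  have : 0 <= n ^+ 3 by rewrite exprn_ge0.
  by lra.
have h1 : n * (n ^+ 3 - n) <= n ^+ 4.
  rewrite (_ : n ^+ 4 = n * n ^+ 3); last by ring.
  by rewrite ler_wpM2l // lerBlDr lerDl.
lra.
Qed.
End Moments.

(** * Choice of the threshold and the final bounds *)

Lemma threshold (a m : nat) : (0 < m)%N -> (0 < a)%N ->
  exists2 k, (a <= k ^ 2 * m)%N & (k.-1 ^ 2 * m <= a)%N.
Proof.
move=> m0 a0; have ex_k : exists k, (a <= k ^ 2 * m)%N.
  by exists a; rewrite -mulnn -mulnA leq_pmulr // muln_gt0 a0.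
case: (ex_minnP ex_k) => k lt_k min_k; exists k => //.
case: k lt_k min_k => [|k] lt_k min_k; first by rewrite mul0n.
by rewrite leqNgt; apply/negP => /ltnW/min_k; rewrite ltnn.
Qed.

(** Working with the square roots s of |A| and t of |F| makes all exponents integral. The minimum is
    its first entry when t <= s ^ 2 and its second when s ^ 2 <= t. *)
Lemma triples_le (R : realType) (F : finFieldType) (A : {set F}) (C0 : nat) (s t : R) :
    (forall k, (2 <= k -> 201 ^ 2 * #|A| ^ 3 <= k ^ 2 * #|F| ->
      #|rich A k| * k ^ 4 <= C0 * #|A| ^ 5)%N) ->
    0 <= s -> 0 <= t -> s ^+ 2 = #|A|%:R -> t ^+ 2 = #|F|%:R ->
  (collinear_triples A)%:R - #|A|%:R ^+ 6 / #|F|%:R <=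
    (4 * C0%:R + 300) * Num.min (t * s ^+ 7) (s ^+ 9).
Proof.
move=> richC s0 t0 sE tE.
have q_gt0 : (0 < #|F|)%N by apply/card_gt0P; exists 0.
have sqr_le (x y : R) : 0 <= x -> 0 <= y -> x ^+ 2 <= y ^+ 2 -> x <= y.
  by move=> x0 y0; rewrite ler_pXn2r.
have [A0|A0] := posnP #|A|.
  have -> : s = 0 by apply/eqP; rewrite -sqrf_eq0 sE A0.
  have -> : collinear_triples A = 0%N.
    have := sum_inc3 A; rewrite big1 ?A0 => [|l _]; first by rewrite !exp0n // muln0; lia.
    by have := inc_le A l; rewrite A0 leqn0 => /eqP->.
  by rewrite A0 !expr0n /= !mulr0 minxx mulr0 mul0r subr0.
have s1 : 1 <= s by apply: sqr_le; rewrite // sE expr1n ler1n.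
have le_st : s <= t by apply: sqr_le; rewrite // sE tE ler_nat max_card.
have s_gt0 : 0 < s by apply: lt_le_trans s1.
have t_gt0 : 0 < t by apply: lt_le_trans le_st.
have le89 : s ^+ 8 <= s ^+ 9 by rewrite (exprS s 8) ler_peMl ?exprn_ge0.
have [le_qn|/ltnW le_nq] := leqP #|F| (#|A| ^ 2).
  have a0 : (0 < 201 ^ 2 * #|A| ^ 3)%N by rewrite muln_gt0 !expn_gt0 A0.
  have [k ge_k le_k] := threshold q_gt0 a0.
  have k_gt0 : (0 < k)%N by case: k ge_k {le_k} => //; rewrite mul0n leqNgt a0.
  have kE : k.-1%:R + 1 = k%:R :> R by rewrite natr1 prednK.
  have ts : t <= s ^+ 2.
    by apply: sqr_le; rewrite ?exprn_ge0 // tE sE -natrX ler_nat.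
  have ge_kR : 201 * s ^+ 3 <= k%:R * t.
    apply: sqr_le; rewrite ?mulr_ge0 ?exprn_ge0 ?ler0n //.
    rewrite (_ : (201 * _) ^+ 2 = 201 ^+ 2 * (s ^+ 2) ^+ 3); last by ring.
    rewrite [(_ * t) ^+ 2]exprMn sE tE.
    by rewrite -!natrX -!natrM ler_nat.
  have le_kR : k.-1%:R * t <= 201 * s ^+ 3.
    apply: sqr_le; rewrite ?mulr_ge0 ?exprn_ge0 ?ler0n //.
    rewrite (_ : (201 * _) ^+ 2 = 201 ^+ 2 * (s ^+ 2) ^+ 3); last by ring.
    rewrite [(_ * t) ^+ 2]exprMn sE tE.
    by rewrite -!natrX -!natrM ler_nat.
  have k201 : 201 * s <= k%:R.
    have s2 : 0 < s ^+ 2 by rewrite exprn_gt0.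
    rewrite -(ler_pM2r s2) -mulrA -exprS (le_trans ge_kR) //.
    by rewrite ler_wpM2l ?ler0n.
  have k2 : (2 <= k)%N by rewrite -(ler_nat R); move: s1 k201; lra.
  have := triples_le_large R richC k2 ge_k.
  rewrite -sE -tE -!exprM -[(2 * 4)%N]/8%N -[(2 * 2)%N]/4%N -[(2 * 5)%N]/10%N.
  move=> /le_trans; apply.
  rewrite min_l; last by rewrite (exprD s 2 7) ler_wpM2r ?exprn_ge0.
  have h1 : s ^+ 8 <= t * s ^+ 7 by rewrite (exprS s 7) ler_wpM2r ?exprn_ge0.
  have h2 : (k%:R - 1) * t ^+ 2 * s ^+ 4 <= 201 * (t * s ^+ 7).
    (* The minimality of k bounds k - 1, which is exactly the factor in [triples_le_large]. *)
    rewrite -kE addrK (_ : _ * s ^+ 4 = (k.-1%:R * t) * (t * s ^+ 4)); last by ring.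
    rewrite (_ : 201 * _ = (201 * s ^+ 3) * (t * s ^+ 4)); last by ring.
    by rewrite ler_wpM2r // mulr_ge0 ?exprn_ge0.
  have h3 : 4 * C0%:R * s ^+ 10 / k%:R <= 4 * C0%:R * (t * s ^+ 7).
    rewrite -mulrA ler_wpM2l ?mulr_ge0 ?ler0n // ler_pdivrMr ?ltr0n //.
    rewrite (_ : s ^+ 10 = s ^+ 3 * s ^+ 7); last by ring.
    rewrite [t * _ * _]mulrAC ler_wpM2r ?exprn_ge0 // mulrC.
    by apply: le_trans ge_kR; rewrite ler_peMl ?exprn_ge0 // ler1n.
  have h0 : 0 <= t * s ^+ 7 by rewrite mulr_ge0 ?exprn_ge0.
  by move: h0 h1 h2 h3; move: (s ^+ 8) (_ * s ^+ 4) (_ / k%:R) (t * s ^+ 7) => *; lra.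
(* For |A| ^ 2 <= |F| the choice k ~ 201 s balances k n ^ 4 against n ^ 5 / k and meets the richness
   condition. *)
have a0 : (0 < 201 ^ 2 * #|A|)%N by rewrite muln_gt0 A0.
have [k] := threshold (ltn0Sn 0) a0; rewrite !muln1 => ge_k le_k.
have k_gt0 : (0 < k)%N by case: k ge_k {le_k} => //; rewrite leqNgt a0.
have kE : k.-1%:R + 1 = k%:R :> R by rewrite natr1 prednK.
have ge_kR : 201 * s <= k%:R.
  by apply: sqr_le; rewrite ?mulr_ge0 ?ler0n // exprMn sE -!natrX -natrM ler_nat.
have le_kR : k.-1%:R <= 201 * s.
  by apply: sqr_le; rewrite ?mulr_ge0 ?ler0n // exprMn sE -!natrX -natrM ler_nat.
have k2 : (2 <= k)%N by rewrite -(ler_nat R); move: s1 ge_kR; lra.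
have kF : (201 ^ 2 * #|A| ^ 3 <= k ^ 2 * #|F|)%N by rewrite (expnD _ 1 2) mulnA leq_mul.
have := triples_le_small R richC k2 kF.
rewrite -sE -!exprM -[(2 * 4)%N]/8%N -[(2 * 5)%N]/10%N => le_T.
have st : s ^+ 2 <= t.
  by apply: sqr_le; rewrite ?exprn_ge0 // tE sE -natrX ler_nat.
rewrite min_r; last by rewrite (exprD s 2 7) ler_wpM2r ?exprn_ge0.
have h0 : 0 <= s ^+ 12 / #|F|%:R by rewrite divr_ge0 ?exprn_ge0 ?ler0n.
have h2 : k%:R * s ^+ 8 <= 202 * s ^+ 9.
  rewrite (exprS s 8) mulrA ler_wpM2r ?exprn_ge0 //; move: le_kR s1; rewrite -kE; lra.
have h3 : 4 * C0%:R * s ^+ 10 / k%:R <= 4 * C0%:R * s ^+ 9.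
  rewrite -mulrA ler_wpM2l ?mulr_ge0 ?ler0n // ler_pdivrMr ?ltr0n //.
  rewrite (_ : s ^+ 10 = s ^+ 9 * s); last by ring.
  by rewrite ler_wpM2l ?exprn_ge0 //; move: s1 ge_kR; lra.
have h4 : 0 <= s ^+ 9 by rewrite exprn_ge0.
rewrite -[(2 * 6)%N]/12%N; move: h0 le89 h2 h3 h4 le_T.
move: (_ / #|F|%:R) (_ / k%:R) (k%:R * _) => y0 y1 y2; move: (s ^+ 9) => y9; move: (s ^+ 8) => y8 *; lra.
Qed.

Theorem theorem33 (R : realType) :
  exists2 C : R, 0 < C &
    forall (p : nat), prime p -> odd p ->
    forall A : {set 'F_p},
      0 <= (collinear_triples A)%:R - (#|A|%:R ^+ 6) / p%:R :> R
      /\ (collinear_triples A)%:R - (#|A|%:R ^+ 6) / p%:R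
         <= C * Num.min (p%:R `^ (1 / 2) * #|A|%:R `^ (7 / 2))
                        (#|A|%:R `^ (9 / 2)).
Proof.
exists (4 * (900 ^ 2)%N%:R + 300).
  by rewrite ltr_wpDl ?mulr_ge0 ?ler0n ?ltr0n.
move=> p p_pr _ A; have cF := card_Fp p_pr.
split; first by have := triples_ge R A; rewrite cF.
have sqr_half m : Num.sqrt (m%:R : R) ^+ 2 = m%:R by rewrite sqr_sqrtr.
have powR_half m k : (m%:R : R) `^ (k%:R / 2) = Num.sqrt m%:R ^+ k.
  by rewrite mulrC powRrM powR12_sqrt // powR_mulrn // sqrtr_ge0.
rewrite (powR_half _ 7) (powR_half _ 9) div1r powR12_sqrt //.
have := @triples_le R 'F_p A (900 ^ 2) (Num.sqrt #|A|%:R) (Num.sqrt p%:R).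
rewrite cF !sqr_half; apply; rewrite ?sqrtr_ge0 // => k k2 kF.
apply: rich_le => //; last by rewrite cF.
move=> m; rewrite cF => /andP[m0 mp].
by rewrite -(dvdn_pcharf (pchar_Fp p_pr)) gtnNdvd.
Qed.
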